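(* Let $A$ be a set in $\mathbb{Z}^d$ with $|A|\le 5$, and let $\Omega:=A+[0,1)^d\subset\mathbb{R}^d$ be the corresponding union of unit cubes. If $\Omega$ is spectral in $\mathbb{R}^d$, then $\Omega$ tiles $\mathbb{R}^d$ by translation.
   Context: A bounded measurable set $\Omega\subset\mathbb{R}^d$ is spectral if there exists a set $\Lambda\subset\mathbb{R}^d$ such that the exponentials $x\mapsto e^{2\pi i\lambda\cdot x}$, $\lambda\in\Lambda$, form an orthogonal basis of $L^2(\Omega)$ (Lebesgue measure). $\Omega$ tiles $\mathbb{R}^d$ by translation if there exists $T\subseteq\mathbb{R}^d$ such that $\sum_{t\in T}\chi_\Omega(x-t)=1$ for almost every $x\in\mathbb{R}^d$. *)

(* Defs.v *)
From HB Require Import structures.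
From mathcomp Require Import all_boot all_order all_algebra finmap.
From mathcomp Require Import all_classical all_reals all_analysis.
Set Implicit Arguments. Unset Strict Implicit. Unset Printing Implicit Defensive.
Import Order.TTheory GRing.Theory Num.Theory numFieldNormedType.Exports.
Local Open Scope classical_set_scope.
Local Open Scope ring_scope.

(** * Lebesgue measure on R^d, built as the iterated product measure
    R^(n+1) = R * R^n, with R^0 = unit carrying the unit point mass. *)

Record Rspace (R : realType) := RSpace {
  rs_disp : measure_display;
  rs_T : measurableType rs_disp;
  rs_mu : {sigma_finite_measure set rs_T -> \bar R} }.

Definition lprod (R : realType) (S : Rspace R) :
  set (measurableTypeR R * rs_T S)%type -> \bar R :=
  (@lebesgue_measure R \x rs_mu S)%E.

HB.instance Definition _ (R : realType) (S : Rspace R) :=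
  Measure.on (@lprod R S).

Lemma lprod_sigma_finite (R : realType) (S : Rspace R) :
  sigma_finite setT (@lprod R S).
Proof.
rewrite /lprod.
have /sigma_finiteP[F [TF ndF Foo]] := sigma_finiteT (@lebesgue_measure R).
have /sigma_finiteP[G [TG ndG Goo]] := sigma_finiteT (rs_mu S).
exists (fun n => F n `*` G n).
  rewrite -setXTT TF TG predeqE => -[x y]; split.
    move=> [/= [n _ Fnx] [k _ Gky]]; exists (maxn n k) => //; split.
    - by move: x Fnx; exact/subsetPset/ndF/leq_maxl.
    - by move: y Gky; exact/subsetPset/ndG/leq_maxr.
  by move=> [n _ []/= ? ?]; split; exists n.
move=> k; have [? ?] := Foo k; have [? ?] := Goo k.
split; first exact: measurableX.
by rewrite product_measure1E// lte_mul_pinfty// ge0_fin_numE.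
Qed.

HB.instance Definition _ (R : realType) (S : Rspace R) :=
  Measure_isSigmaFinite.Build _ _ _ (@lprod R S) (lprod_sigma_finite S).

Definition prodsp (R : realType) (S : Rspace R) : Rspace R :=
  @RSpace R _ (measurableTypeR R * rs_T S)%type (@lprod R S).

Definition unitsp (R : realType) : Rspace R :=
  @RSpace R _ unit (\d_tt : {sigma_finite_measure set unit -> \bar R}).

Fixpoint Rsp (R : realType) (d : nat) : Rspace R :=
  match d with 0 => unitsp R | n.+1 => prodsp (Rsp R n) end.

Definition Rd (R : realType) (d : nat) : measurableType (rs_disp (Rsp R d)) :=
  rs_T (Rsp R d).
Definition leb (R : realType) (d : nat) :
  {sigma_finite_measure set (Rd R d) -> \bar R} := rs_mu (Rsp R d).

Fixpoint rcoord (R : realType) (d : nat) : Rd R d -> nat -> R :=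
  match d with
  | 0 => fun _ _ => 0
  | n.+1 => fun x i => if i is j.+1 then @rcoord R n x.2 j else x.1
  end.

Fixpoint rsub (R : realType) (d : nat) : Rd R d -> Rd R d -> Rd R d :=
  match d with
  | 0 => fun x _ => x
  | n.+1 => fun x y => ((x.1 - y.1 : R), @rsub R n x.2 y.2)
  end.

Definition rdot (R : realType) (d : nat) (x y : Rd R d) : R :=
  \sum_(i < d) rcoord x i * rcoord y i.

Definition cube_union (R : realType) (d : nat) (A : {fset 'rV[int]_d}) :
  set (Rd R d) :=
  [set x | exists2 a, a \in A &
     forall i : 'I_d, (a ord0 i)%:~R <= rcoord x i < (a ord0 i)%:~R + 1].

(** f = u + i v (u, v real-valued) belongs to L^2(Omega). *)
Definition L2 (R : realType) (d : nat) (Om : set (Rd R d)) (u v : Rd R d -> R) :=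
  [/\ measurable_fun Om u, measurable_fun Om v &
      (\int[leb R d]_(x in Om) ((u x) ^+ 2 + (v x) ^+ 2)%:E < +oo)%E].

(** Omega is spectral: there is Lambda such that the exponentials
    e_l(x) = exp(2 pi i l.x), l in Lambda, form an orthogonal basis of
    L^2(Omega): they are pairwise orthogonal, and the only f in L^2(Omega)
    orthogonal to all of them is f = 0 (a.e. on Omega). Complex-valued
    quantities are written through their real and imaginary parts:
    <e_l, e_m> = int_Om cos(2pi(l-m).x) + i int_Om sin(2pi(l-m).x),
    <f, e_l> = int_Om (u cos t + v sin t) + i int_Om (v cos t - u sin t),
    with t = 2 pi l.x and f = u + i v. *)
Definition spectral (R : realType) (d : nat) (Om : set (Rd R d)) : Prop :=
  exists Lambda : set (Rd R d),
    (forall l m, Lambda l -> Lambda m -> l <> m ->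
       (\int[leb R d]_(x in Om) (cos (2 * pi * rdot (rsub l m) x))%:E = 0)%E /\
       (\int[leb R d]_(x in Om) (sin (2 * pi * rdot (rsub l m) x))%:E = 0)%E)
    /\
    (forall u v : Rd R d -> R, L2 Om u v ->
       (forall l, Lambda l ->
          (\int[leb R d]_(x in Om)
              (u x * cos (2 * pi * rdot l x) + v x * sin (2 * pi * rdot l x))%:E
             = 0)%E /\
          (\int[leb R d]_(x in Om)
              (v x * cos (2 * pi * rdot l x) - u x * sin (2 * pi * rdot l x))%:E
             = 0)%E) ->
       {ae leb R d, forall x, Om x -> u x = 0 /\ v x = 0}).

Definition tiles (R : realType) (d : nat) (Om : set (Rd R d)) : Prop :=
  exists T : set (Rd R d),
    {ae leb R d, forall x, (\esum_(t in T) ((\1_Om (rsub x t) : R))%:E = 1)%E}.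

(* Main.v *)
(** Every spectrum of Omega has at least |A| points in some unit cell
    k + [0,1)^d: otherwise Parseval's identity, applied to the exponentials with
    frequencies in a large box cut off to one unit cube of Omega, would
    contradict the decay of the Fourier transform of that cube. Differences of
    points of one cell lie in (-1,1)^d, where this transform does not vanish, so
    orthogonality over Omega becomes orthogonality over A and the matrix
    (exp(2 pi i l.a)) is a complex Hadamard matrix of order |A| <= 5.
    Up to dephasing, some row of such a matrix runs through all |A|-th roots of
    unity, or |A| = 4 and some row is a rearrangement of (1, 1, -1, -1) (for
    order 5 this is Haagerup's theorem). Reading off the argument of the
    corresponding character(s) tells which translate of A a point of Z^d belongs
    to, and the resulting tiling of Z^d by A induces one of R^d by Omega. *)
Require Import Defs.
From HB Require Import structures.
From mathcomp Require Import all_boot all_order all_algebra finmap.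
From mathcomp Require Import ring lra zify.
From mathcomp Require Import complex.
From mathcomp Require Import all_classical all_reals all_analysis.
From mathcomp Require Import measurable_realfun.
Set Implicit Arguments. Unset Strict Implicit. Unset Printing Implicit Defensive.
Import Order.TTheory GRing.Theory Num.Theory numFieldNormedType.Exports.
Local Open Scope classical_set_scope.
Local Open Scope ring_scope.

(** * Complex Hadamard matrices of order at most five *)

(** Completeness is only given in the form that nothing nonzero is orthogonal to the spectrum, and
    the spectrum is an arbitrary set, with no enumeration supplied. Parseval is therefore proved
    approximately, through finite subfamilies whose residual norm nearly attains its infimum;
    completeness of L^2 yields a limit orthogonal to the whole spectrum, hence zero. Everything
    afterwards concerns finite sums. Over frequencies in [{0,...,N-1}^d], the squared coefficients
    at a point sum to a product over coordinates of [sinc_sum N], which is at most 1 and small away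
    from [[0,N)]. With at most |A| - 1 points per cell the total stays below about (|A| - 1) N^d,
    whereas Parseval gives nearly |A| N^d. In order five, pointwise products of rows are expanded in
    the basis of rows; Parseval relations between the structure constants force a row whose second
    power sum vanishes. Newton's identities and conjugation then identify its entries with the fifth
    roots of unity. *)

Section HadamardMatrices.
Variable C : numClosedFieldType.

Lemma unimod_mul_conj (z : C) : `|z| = 1 -> z * z^* = 1.
Proof. by move=> z1; rewrite -normCK z1 expr1n. Qed.

(** Writing each sign as [1 - 2 * b] with [b] equal to 0 or 1, a zero sum would make [n] twice an
    integer. *)
Lemma sum_pm1_odd_neq0 n (y : 'I_n -> C) :
  odd n -> (forall m, y m ^+ 2 = 1) -> \sum_m y m != 0.
Proof.
move=> on y1; apply/negP => /eqP s0.
have yE m : y m = 1 - 2 * (y m != 1)%:R.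
  have := y1 m; rewrite -[RHS](expr1n C 2) => /eqP; rewrite eqf_sqr.
  case: (eqVneq (y m) 1) => [-> _|_ /= /eqP->] /=; first by rewrite mulr0 subr0.
  by ring.
move: s0; rewrite (eq_bigr _ (fun m _ => yE m)) sumrB -mulr_sumr -natr_sum.
rewrite sumr_const card_ord => /eqP; rewrite subr_eq0 -natrM eqr_nat => /eqP nE.
by move: on; rewrite nE mul2n odd_double.
Qed.

(** * Rows of a complex Hadamard matrix as an orthogonal basis *)

Section Basis.
Variables (n : nat) (h : 'I_n -> 'I_n -> C).
Hypothesis h1 : forall i m, `|h i m| = 1.
Hypothesis hort : forall i j, i != j -> \sum_m h i m * (h j m)^* = 0.

Lemma hadamard_row_dot i j : \sum_m h i m * (h j m)^* = n%:R * (i == j)%:R.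
Proof.
case: eqVneq => [->|/hort ->]; last by rewrite mulr0.
by rewrite (eq_bigr (fun=> 1)) ?sumr_const ?card_ord ?mulr1 // => m _; exact: unimod_mul_conj.
Qed.

(** Row orthogonality gives the square matrix [M] a right inverse, the scaled adjoint [M']; it is
    then also a left inverse, which is column orthogonality. *)
Lemma hadamard_col_dot p q : \sum_i (h i p)^* * h i q = n%:R * (p == q)%:R.
Proof.
case: n h h1 hort p q hadamard_row_dot => [|n'] h' _ _ p q rd; first by case: p.
pose M := \matrix_(i < n'.+1, m < n'.+1) h' i m.
pose M' := \matrix_(m < n'.+1, i < n'.+1) (n'.+1%:R^-1 * (h' i m)^*).
have n0 : n'.+1%:R != 0 :> C by rewrite pnatr_eq0.
have MM' : M *m M' = 1%:M.
  apply/matrixP => i j; rewrite !mxE.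
  transitivity (n'.+1%:R^-1 * \sum_m h' i m * (h' j m)^*).
    by rewrite mulr_sumr; apply: eq_bigr => m _; rewrite !mxE; ring.
  by rewrite rd mulrA mulVf // mul1r.
have /matrixP/(_ p q) := mulmx1C MM'; rewrite !mxE => <-.
rewrite mulr_sumr; apply: eq_bigr => i _; rewrite !mxE.
by rewrite !mulrA divff // mul1r.
Qed.

Lemma hadamard_expand (v : 'I_n -> C) p :
  n%:R * v p = \sum_i (\sum_m v m * (h i m)^*) * h i p.
Proof.
transitivity (\sum_m v m * \sum_i (h i m)^* * h i p).
  rewrite (bigD1 p) //= hadamard_col_dot eqxx mulr1 big1 ?addr0 1?mulrC //.
  by move=> m /negPf mp; rewrite hadamard_col_dot mp !mulr0.
transitivity (\sum_m \sum_i v m * (h i m)^* * h i p).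
  by apply: eq_bigr => m _; rewrite mulr_sumr; apply: eq_bigr => i _; rewrite mulrA.
by rewrite exchange_big; apply: eq_bigr => i _; rewrite mulr_suml.
Qed.

Lemma hadamard_parseval (v w : 'I_n -> C) :
  \sum_i (\sum_m v m * (h i m)^*) * (\sum_m w m * (h i m)^*)^* =
  n%:R * \sum_m v m * (w m)^*.
Proof.
rewrite mulr_sumr.
under [RHS]eq_bigr => m _ do rewrite mulrA hadamard_expand mulr_suml.
rewrite exchange_big; apply: eq_bigr => i _.
rewrite rmorph_sum mulr_sumr; apply: eq_bigr => m _.
rewrite rmorphM /= conjCK; ring.
Qed.

End Basis.

(** * Order five: structure constants of the row products *)

Section Order5.
Variable h : 'I_5 -> 'I_5 -> C.
Hypothesis h1 : forall i m, `|h i m| = 1.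
Hypothesis hort : forall i j, i != j -> \sum_m h i m * (h j m)^* = 0.
Hypothesis hr0 : forall m, h 0 m = 1.
Hypothesis hc0 : forall i, h i 0 = 1.

(* [N i j k / 5] are the structure constants of the pointwise multiplication of
   rows in the orthogonal basis of rows. *)
Let N i j k := \sum_m h i m * h j m * (h k m)^*.

Let NC i j k : N i j k = N j i k.
Proof. by apply: eq_bigr => m _; rewrite (mulrC (h i m)). Qed.

Let row_sum0 i : i != 0 -> \sum_m h i m = 0.
Proof.
by move=> /hort e; rewrite -[RHS]e; apply: eq_bigr => m _; rewrite hr0 conjC1 mulr1.
Qed.

(** Unimodularity reduces the constant to a row sum. Together with [Niji], this leaves only row 0
    and two other rows in the expansion of a product of two distinct nontrivial rows. *)
Let Nijj i j : i != 0 -> N i j j = 0.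
Proof.
move=> /row_sum0 e; rewrite -[RHS]e; apply: eq_bigr => m _.
by rewrite -mulrA unimod_mul_conj ?mulr1.
Qed.

Let Niji i j : j != 0 -> N i j i = 0.
Proof. by move=> j0; rewrite NC Nijj. Qed.

Let sum5 (F : 'I_5 -> C) i j k l : uniq [:: 0 : 'I_5; i; j; k; l] ->
  \sum_m F m = F 0 + F i + F j + F k + F l.
Proof.
move=> u; rewrite -big_enum (perm_big [:: 0; i; j; k; l]) /=; last first.
  have sub : {subset [:: 0; i; j; k; l] <= enum 'I_5} by move=> y; rewrite mem_enum.
  have [_ e] := uniq_min_size u sub (eq_leq (size_enum_ord 5)).
  by apply: uniq_perm => //; rewrite ?enum_uniq.
by rewrite !big_cons big_nil addr0 !addrA.
Qed.

Let uniq5E i j k l : uniq [:: 0 : 'I_5; i; j; k; l] ->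
  [/\ i != 0, j != 0, k != 0 & l != 0] /\
  [/\ i != j, i != k, i != l, j != k & j != l] /\ k != l.
Proof.
rewrite /= !inE !negb_or -!andbA (eq_sym 0 i) (eq_sym 0 j) (eq_sym 0 k) (eq_sym 0 l).
by move=> /and5P[-> -> -> -> /and5P[-> -> -> -> /and3P[-> -> _]]].
Qed.

(** Parseval for the product of rows [i] and [j], whose entries are unimodular: the right side is
    [5 * 5]. *)
Let norm_eq i j k l : uniq [:: 0 : 'I_5; i; j; k; l] ->
  `|N i j 0| ^+ 2 + `|N i j k| ^+ 2 + `|N i j l| ^+ 2 = 25.
Proof.
move=> u; have [[i0 j0 k0 l0] _] := uniq5E u.
have := hadamard_parseval h1 hort (fun m => h i m * h j m) (fun m => h i m * h j m).
rewrite (sum5 _ u) -/(N i j 0) -/(N i j i) -/(N i j j) -/(N i j k) -/(N i j l).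
rewrite Niji // Nijj // !mul0r !addr0 !normCK => ->.
rewrite (eq_bigr (fun=> 1)) ?sumr_const ?card_ord -?natrM //.
by move=> m _; rewrite unimod_mul_conj // normrM !h1 mulr1.
Qed.

(** The unimodular factor [h i] cancels in the inner product of [h i * h j] with [h i * h k], which
    is thus that of rows [j] and [k]. On the Parseval side only rows 0 and [l] can carry nonzero
    coefficients of both products. *)
Let orth_eq i j k l : uniq [:: 0 : 'I_5; i; j; k; l] ->
  N i j 0 * (N i k 0)^* + N i j l * (N i k l)^* = 0.
Proof.
move=> u; have [[i0 j0 k0 l0] [[ij ik il jk jl] kl]] := uniq5E u.
have := hadamard_parseval h1 hort (fun m => h i m * h j m) (fun m => h i m * h k m).
rewrite (sum5 _ u) -/(N i j 0) -/(N i j i) -/(N i j j) -/(N i j k) -/(N i j l).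
rewrite -/(N i k 0) -/(N i k i) -/(N i k j) -/(N i k k) -/(N i k l).
rewrite Niji // Nijj // (@Nijj i k) // conjC0 mulr0 !mul0r !addr0 => ->.
rewrite -[RHS](mulr0 5); congr (_ * _); rewrite -[RHS](hort jk).
by apply: eq_bigr => m _; rewrite rmorphM mulrACA unimod_mul_conj ?mul1r.
Qed.

Let expand i j k l p : uniq [:: 0 : 'I_5; i; j; k; l] ->
  5 * (h i p * h j p) = N i j 0 + N i j k * h k p + N i j l * h l p.
Proof.
move=> u; have [[i0 j0 k0 l0] _] := uniq5E u.
rewrite (hadamard_expand h1 hort (fun m => h i m * h j m)) (sum5 _ u).
rewrite -/(N i j 0) -/(N i j i) -/(N i j j) -/(N i j k) -/(N i j l).
by rewrite Niji // Nijj // hr0 !mul0r !addr0 mulr1.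
Qed.

Let five_neq0 : 5 != 0 :> C. Proof. by rewrite pnatr_eq0. Qed.

Let prod_row i j k l : uniq [:: 0 : 'I_5; i; j; k; l] -> N i j 0 = 0 -> N i j l = 0 ->
  forall m, h i m * h j m = h k m.
Proof.
move=> u a0 b0 m; apply: (mulfI five_neq0).
have e p := expand p u; move: (e 0) (e m).
by rewrite a0 b0 !hc0 !mul0r !addr0 !add0r !mulr1 => <-.
Qed.

(* If both coefficients in [5 h_i h_j = a + b h_k] were nonzero, then [|h_i h_j| = 1]
   would force [h_k] to be [1] or [-1] everywhere, but an odd number of signs does
   not sum to zero. *)
Let prod_two i j k l : uniq [:: 0 : 'I_5; i; j; k; l] -> N i j l = 0 ->
  (forall m, h i m * h j m = 1) \/ (forall m, h i m * h j m = h k m).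
Proof.
move=> u b0; have e p := expand p u.
have [a0|a0] := eqVneq (N i j 0) 0; first by right; apply: (prod_row u).
have [c0|c0] := eqVneq (N i j k) 0.
  left=> m; apply: (mulfI five_neq0); move: (e 0) (e m).
  by rewrite b0 c0 !hc0 !mul0r !addr0 !mulr1 => <-.
have [[i0 j0 k0 l0] _] := uniq5E u.
have y2 m : h k m ^+ 2 = 1.
  (* The expansion has squared modulus 25 at each column, and by [norm_eq] the two squared
     coefficients already add up to 25; so the cross terms cancel. *)
  have E p : N i j 0 * (N i j k)^* * (h k p)^* + (N i j 0)^* * N i j k * h k p = 0.
    have /= := congr1 (fun z => z * z^*) (e p).
    rewrite b0 mul0r addr0 !rmorphM /= conjC_nat rmorphD /= rmorphM /=.
    rewrite [LHS](_ : _ = 25 * (h i p * (h i p)^*) * (h j p * (h j p)^*)); last by ring.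
    rewrite !unimod_mul_conj // !mulr1 => e25.
    have := norm_eq u; rewrite b0 normr0 expr0n addr0 !normCK => n25.
    have := unimod_mul_conj (h1 k p); set y := h k p; set a := N i j 0; set b := N i j k.
    move: n25 e25; rewrite -/a -/b -/y => n25 e25 yy.
    have -> : a * b^* * y^* + a^* * b * y =
      (a + b * y) * (a^* + b^* * y^*) - (a * a^* + b * b^* * (y * y^*)) by ring.
    by rewrite -e25 yy mulr1 n25; ring.
  (* At column 0, where [h k 0 = 1], the two coefficients in [E] are seen to be opposite; at column
     [m] this makes [h k m] equal to its conjugate. *)
  have E0 := E 0; have Em := E m; rewrite hc0 conjC1 !mulr1 in E0.
  have yy := unimod_mul_conj (h1 k m).
  have ab : N i j 0 * (N i j k)^* != 0 by rewrite mulf_neq0 ?conjC_eq0.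
  apply: (mulfI ab); rewrite mulr1.
  move: E0 Em yy; set y := h k m; set a := N i j 0 * _; set b := (N i j 0)^* * _ => E0 Em yy.
  have -> : a * y ^+ 2 = a * (y * y^*) - y * (a * y^* + b * y) + (a + b) * y ^+ 2.
    by ring.
  by rewrite yy E0 Em; ring.
by have := @sum_pm1_odd_neq0 5 _ isT y2; rewrite row_sum0 ?eqxx.
Qed.

Ltac perm_uniq5 u :=
  refine (etrans (perm_uniq _) u); let p := fresh in apply/permP => p /=; by do 5!case: (p _).

(** For the moduli [a], [b], [c] of the constants at row 0 and [a'], [b'], [c'] at row [l],
    [orth_eq] gives [a b = a' b'], [a c = a' c'] and [b c = b' c']. Multiply the first two and
    cancel [b c]. *)
Let pairs_nonzero i j k l : uniq [:: 0 : 'I_5; i; j; k; l] ->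
  N i j 0 != 0 -> N i k 0 != 0 -> N j k 0 != 0 -> `|N i j 0| = `|N i j l|.
Proof.
move=> u aij aik ajk.
have E i' j' k' : uniq [:: 0 : 'I_5; i'; j'; k'; l] ->
    `|N i' j' 0| * `|N i' k' 0| = `|N i' j' l| * `|N i' k' l|.
  move=> /orth_eq/eqP; rewrite addr_eq0 => /eqP/(congr1 Num.norm).
  by rewrite normrN !normrM !norm_conjC.
have e1 := E i j k u.
have u2 : uniq [:: 0 : 'I_5; j; i; k; l] by perm_uniq5 u.
have u3 : uniq [:: 0 : 'I_5; k; i; j; l] by perm_uniq5 u.
have e2 := E j i k u2; rewrite (NC j i 0) (NC j i l) in e2.
have e3 := E k i j u3; rewrite (NC k i 0) (NC k i l) (NC k j 0) (NC k j l) in e3.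
rewrite -normr_eq0 in aik; rewrite -normr_eq0 in ajk; move: aik ajk e1 e2 e3.
set a := `|N i j 0|; set b := `|N i k 0|; set c := `|N j k 0|.
move=> aik ajk e1 e2 e3; apply/eqP; rewrite -(@eqrXn2 _ 2) ?normr_ge0 //; apply/eqP.
apply: (mulIf (mulf_neq0 aik ajk)); rewrite -/b -/c.
transitivity ((a * b) * (a * c)); first by ring.
by rewrite e1 e2; transitivity (`|N i j l| ^+ 2 * (`|N i k l| * `|N j k l|));
  [ring|rewrite -e3; ring].
Qed.

(** Here [h i * h j = h k], and [prod_two] leaves [h i * h l] equal to 1 or [h j], and [h j * h l]
    equal to 1 or [h i]. Two values 1 would identify rows [i] and [j]; two other values would make
    [h l] a row of signs; a mixed outcome makes one of the rows [i], [j] the square of the other. *)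
Let case_product i j k l : uniq [:: 0 : 'I_5; i; j; k; l] ->
  N i j 0 = 0 -> N i j l = 0 -> exists2 p, p != 0 & \sum_m h p m ^+ 2 = 0.
Proof.
move=> u a0 b0; have [[i0 j0 k0 l0] [[ij ik il jk jl] kl]] := uniq5E u.
have xy := prod_row u a0 b0.
have c0 : N i j k != 0.
  apply/negP => /eqP c0; have := norm_eq u.
  by rewrite a0 b0 c0 normr0 expr0n !addr0 => /esym/eqP; rewrite pnatr_eq0.
have u2 : uniq [:: 0 : 'I_5; i; j; l; k] by perm_uniq5 u.
have u3 : uniq [:: 0 : 'I_5; j; i; l; k] by perm_uniq5 u.
have u4 : uniq [:: 0 : 'I_5; i; l; j; k] by perm_uniq5 u.
have u5 : uniq [:: 0 : 'I_5; j; l; i; k] by perm_uniq5 u.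
have xw0 : N i l k = 0.
  have /eqP := orth_eq u2; rewrite a0 mul0r add0r mulf_eq0 (negPf c0) /=.
  by rewrite conjC_eq0 => /eqP.
have yw0 : N j l k = 0.
  have /eqP := orth_eq u3; rewrite (NC j i 0) a0 mul0r add0r mulf_eq0.
  by rewrite (NC j i k) (negPf c0) /= conjC_eq0 => /eqP.
have h0 p m : h p m != 0 by rewrite -normr_eq0 h1 oner_eq0.
case: (prod_two u4 xw0) (prod_two u5 yw0) => [xw|xw] [yw|yw].
- have : \sum_m h i m * (h j m)^* = 0 by apply: hort.
  rewrite (eq_bigr (fun=> 1)) ?sumr_const ?card_ord => [/eqP|m _].
    by rewrite pnatr_eq0.
  have /(mulIf (h0 l m)) -> : h i m * h l m = h j m * h l m by rewrite xw yw.
  by rewrite unimod_mul_conj.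
- exists i => //; rewrite -[RHS](row_sum0 j0); apply: eq_bigr => m _.
  by apply: (mulIf (h0 l m)); rewrite yw expr2 -mulrA xw mulr1.
- exists j => //; rewrite -[RHS](row_sum0 i0); apply: eq_bigr => m _.
  by apply: (mulIf (h0 l m)); rewrite xw expr2 -mulrA yw mulr1.
- have w2 m : h l m ^+ 2 = 1.
    by apply: (mulfI (h0 i m)); rewrite mulr1 expr2 mulrA xw yw.
  by have := @sum_pm1_odd_neq0 5 _ isT w2; rewrite row_sum0 ?eqxx.
Qed.

(** If neither remaining constant vanishes, [orth_eq] kills four others, and [prod_two] confines
    [h i * h k], [h i * h l] to 1 or [h j], and [h j * h k], [h j * h l] to 1 or [h i]. As rows
    differ, the first pair takes both its values; then a product in the second pair equals row [k]
    or [l], a contradiction. *)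
Let case_zero i j k l : uniq [:: 0 : 'I_5; i; j; k; l] ->
  N i j 0 = 0 -> exists2 p, p != 0 & \sum_m h p m ^+ 2 = 0.
Proof.
move=> u a0; have [[i0 j0 k0 l0] [[ij ik il jk jl] kl]] := uniq5E u.
have u' : uniq [:: 0 : 'I_5; i; j; l; k] by perm_uniq5 u.
have [b0|b0] := eqVneq (N i j l) 0; first exact: case_product u a0 b0.
have [c0|c0] := eqVneq (N i j k) 0; first exact: case_product u' a0 c0.
have vanish i' j' k' l' : uniq [:: 0 : 'I_5; i'; j'; k'; l'] ->
    N i' j' 0 = 0 -> N i' j' l' != 0 -> N i' k' l' = 0.
  move=> v a0' /negPf b0'; have /eqP := orth_eq v.
  by rewrite a0' mul0r add0r mulf_eq0 b0' /= conjC_eq0 => /eqP.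
have w1 : uniq [:: 0 : 'I_5; j; i; k; l] by perm_uniq5 u.
have w2 : uniq [:: 0 : 'I_5; j; i; l; k] by perm_uniq5 u.
have xz0 := vanish _ _ _ _ u a0 b0.
have xw0 := vanish _ _ _ _ u' a0 c0.
have yz0 := vanish _ _ _ _ w1; rewrite (NC j i 0) (NC j i l) in yz0; have {}yz0 := yz0 a0 b0.
have yw0 := vanish _ _ _ _ w2; rewrite (NC j i 0) (NC j i k) in yw0; have {}yw0 := yw0 a0 c0.
have p1 : uniq [:: 0 : 'I_5; i; k; j; l] by perm_uniq5 u.
have p2 : uniq [:: 0 : 'I_5; i; l; j; k] by perm_uniq5 u.
have p3 : uniq [:: 0 : 'I_5; j; k; i; l] by perm_uniq5 u.
have p4 : uniq [:: 0 : 'I_5; j; l; i; k] by perm_uniq5 u.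
have h0 p m : h p m != 0 by rewrite -normr_eq0 h1 oner_eq0.
have neq p q : p != q -> ~ (forall m, h p m = h q m).
  move=> /hort s0 e; move: s0; rewrite (eq_bigr (fun=> 1)) => [|m _].
    by rewrite sumr_const card_ord => /eqP; rewrite pnatr_eq0.
  by rewrite e unimod_mul_conj.
have xz := prod_two p1 xz0; have xw := prod_two p2 xw0.
have yz := prod_two p3 yz0; have yw := prod_two p4 yw0.
exfalso.
case: xz xw => [xz|xz] [xw|xw].
- by apply: (neq k l) => // m; apply: (mulfI (h0 i m)); rewrite xz xw.
- have yzw m : h j m * h k m = h l m by rewrite -xw mulrAC xz mul1r.
  case: yz => yz; first by apply: (neq l 0) => // m; rewrite -yzw yz hr0.
  by apply: (neq l i) => [|m]; rewrite 1?eq_sym // -yzw yz.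
- have ywz m : h j m * h l m = h k m by rewrite -xz mulrAC xw mul1r.
  case: yw => yw; first by apply: (neq k 0) => // m; rewrite -ywz yw hr0.
  by apply: (neq k i) => [|m]; rewrite 1?eq_sym // -ywz yw.
- by apply: (neq k l) => // m; apply: (mulfI (h0 i m)); rewrite xz xw.
Qed.

Let uniq5_ext i j : i != 0 -> j != 0 -> i != j ->
  exists k l, uniq [:: 0 : 'I_5; i; j; k; l].
Proof.
move=> i0 j0 ij.
have /cards2P[k [l [kl E]]] : #|~: [set (0 : 'I_5); i; j]| == 2%N.
  by rewrite cardsCs finset.setCK card_ord -finset.setUA !cardsU1 cards1 !inE (eq_sym 0 i)
    (negPf i0)
     (eq_sym 0 j) (negPf j0) (negPf ij).
exists k, l; have : k \in ~: [set (0 : 'I_5); i; j] by rewrite E !inE eqxx.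
have : l \in ~: [set (0 : 'I_5); i; j] by rewrite E !inE eqxx orbT.
rewrite !inE !negb_or -!andbA => /and3P[l0 li lj] /and3P[k0 ki kj] /=.
by rewrite !inE !negb_or (eq_sym 0 i) (eq_sym 0 j) (eq_sym 0 k) (eq_sym 0 l)
   (eq_sym i k) (eq_sym j k) (eq_sym i l) (eq_sym j l) i0 j0 k0 l0 ij ki kj li lj kl.
Qed.

(* If no [N i j 0] vanishes, all the moduli [|N i j k|] with [i], [j], [k] distinct
   agree and there is no room left for [N i i 0]. *)
Lemma hadamard5_row : exists2 p, p != 0 & \sum_m h p m ^+ 2 = 0.
Proof.
have [/existsP[i /existsP[j /and4P[i0 j0 ij /eqP a0]]]|/existsPn nz] := boolP
    [exists i, exists j, [&& i != 0, j != 0, i != j & N i j 0 == 0]].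
  by have [k [l u]] := uniq5_ext i0 j0 ij; exact: case_zero u a0.
have {}nz i j : i != 0 -> j != 0 -> i != j -> N i j 0 != 0.
  move=> i0 j0 ij; have /existsPn/(_ j) := nz i.
  by rewrite i0 j0 ij.
have third i j k l : uniq [:: 0 : 'I_5; i; j; k; l] -> 3 * `|N i j 0| ^+ 2 = 25.
  move=> u; have [[i0 j0 k0 l0] [[ij ik il jk jl] kl]] := uniq5E u.
  have u' : uniq [:: 0 : 'I_5; i; j; l; k] by perm_uniq5 u.
  have := norm_eq u.
  rewrite -(pairs_nonzero u) -?(pairs_nonzero u'); try by apply: nz.
  by move=> <-; ring.
have neq12 : inord 1 != inord 2 :> 'I_5 by rewrite -val_eqE /= !inordK.
have [i0 j0] : inord 1 != 0 :> 'I_5 /\ inord 2 != 0 :> 'I_5.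
  by rewrite -!val_eqE /= !inordK.
have [k [l u]] := uniq5_ext i0 j0 neq12.
move: (inord 1) (inord 2) i0 j0 neq12 u => i j i0 j0 ij u.
(* Parseval for the conjugate of row [i]: the squared coefficients total 25, and rows [j], [k], [l]
   contribute 25/3 each. *)
exists i => //; have := hadamard_parseval h1 hort (fun m => (h i m)^*) (fun m => (h i m)^*).
have E p : \sum_m (h i m)^* * (h p m)^* = (N i p 0)^*.
  rewrite rmorph_sum; apply: eq_bigr => m _.
  by rewrite !rmorphM /= hr0 conjC1 conjC1 mulr1.
rewrite (eq_bigr (fun p => `|N i p 0| ^+ 2)) => [|p _]; last first.
  by rewrite E conjCK mulrC normCK.
rewrite (sum5 _ u) (_ : N i 0 0 = 0); last first.
  by rewrite -[RHS](row_sum0 i0); apply: eq_bigr => m _; rewrite hr0 conjC1 !mulr1.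
rewrite (eq_bigr (fun=> 1)) ?sumr_const ?card_ord => [|m _]; last first.
  by rewrite unimod_mul_conj // norm_conjC h1.
have u2 : uniq [:: 0 : 'I_5; i; k; j; l] by perm_uniq5 u.
have u3 : uniq [:: 0 : 'I_5; i; l; j; k] by perm_uniq5 u.
have e1 := third _ _ _ _ u; have e2 := third _ _ _ _ u2; have e3 := third _ _ _ _ u3.
rewrite normr0 -natrM => e.
have /eqP : 3 * `|N i i 0| ^+ 2 = 0.
  have -> : `|N i i 0| ^+ 2 = 25 - `|N i j 0| ^+ 2 - `|N i k 0| ^+ 2 - `|N i l 0| ^+ 2.
    by rewrite (_ : 25 = 5%:R * 5%:R :> C) -?natrM // -[25]e; ring.
  by rewrite !mulrBr e1 e2 e3; ring.
rewrite mulf_eq0 pnatr_eq0 /= sqrf_eq0 normr_eq0 => /eqP Nii.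
rewrite -[RHS]Nii; apply: eq_bigr => m _.
by rewrite hr0 conjC1 mulr1 expr2.
Qed.

End Order5.

(* The power sums p_1, p_2 and, by conjugation, p_{-1}, p_{-2} vanish; hence so
   do e_1, e_2, e_4, e_3 and the r_m are the roots of t^5 = e_5. *)
Lemma five_unimod_pow5 (r : 'I_5 -> C) : (forall m, `|r m| = 1) ->
  \sum_m r m = 0 -> \sum_m r m ^+ 2 = 0 -> forall m n, r m ^+ 5 = r n ^+ 5.
Proof.
move=> r1 s1 s2; have r0 m : r m != 0 by rewrite -normr_eq0 r1 oner_eq0.
have inv m : (r m)^* = (r m)^-1.
  by apply: (mulfI (r0 m)); rewrite unimod_mul_conj // divff.
have t1 : \sum_m (r m)^-1 = 0.
  rewrite -[RHS]conjC0 -[X in _ = X^*]s1 rmorph_sum; apply: eq_bigr => m _; exact/esym/inv.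
have t2 : \sum_m (r m)^-1 ^+ 2 = 0.
  rewrite -[RHS]conjC0 -[X in _ = X^*]s2 rmorph_sum; apply: eq_bigr => m _.
  by rewrite -inv; exact/esym/rmorphXn.
suff E m : r m ^+ 5 = \prod_k r k by move=> m n; rewrite !E.
have : \prod_k (r m - r k) = 0 by rewrite (bigD1 m) //= subrr mul0r.
move: (r m) => t; move: s1 s2 t1 t2; rewrite !big_ord_recl !big_ord0 !addr0 !mulr1.
move: (r _) (r0 ord0) => a a0; move: (r _) (r0 (lift ord0 ord0)) => b b0.
move: (r _) (r0 (lift ord0 (lift ord0 ord0))) => c c0.
move: (r _) (r0 (lift ord0 (lift ord0 (lift ord0 ord0)))) => d d0.
move: (r _) (r0 (lift ord0 (lift ord0 (lift ord0 (lift ord0 ord0))))) => e e0.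
move=> s1 s2 t1 t2 P.
have n2 : 2 != 0 :> C by rewrite pnatr_eq0.
set S1 := (X in X = 0) in s1; set S2 := (X in X = 0) in s2.
set T1 := (X in X = 0) in t1; set T2 := (X in X = 0) in t2.
(* The polynomial with the five roots, expanded: e_2 comes from Newton's identity, and e_3, e_4 are
   e_5 times e_2, e_1 of the inverses. *)
have -> : t ^+ 5 = (t - a) * ((t - b) * ((t - c) * ((t - d) * (t - e)))) +
  S1 * t ^+ 4 - (S1 ^+ 2 - S2) / 2 * t ^+ 3
  + (a * (b * (c * (d * e)))) * ((T1 ^+ 2 - T2) / 2 * t ^+ 2 - T1 * t + 1).
  by rewrite /S1 /S2 /T1 /T2; field; rewrite a0 b0 c0 d0 e0.
by rewrite P s1 s2 t1 t2; field.
Qed.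

(** Conjugation inverts unimodular numbers, so the sum of the inverses vanishes too, and
    [(1 + a) (1 + b) (1 + c)] is the sum plus [a b c] times the sum of the inverses. *)
Lemma four_unimod_sum0 (a b c : C) : `|a| = 1 -> `|b| = 1 -> `|c| = 1 ->
  1 + a + b + c = 0 -> [\/ a = -1, b = -1 | c = -1].
Proof.
move=> a1 b1 c1 s0.
have n0 (z : C) : `|z| = 1 -> z != 0 by move=> z1; rewrite -normr_eq0 z1 oner_eq0.
have inv (z : C) : `|z| = 1 -> z^* = z^-1.
  by move=> z1; apply: (mulfI (n0 _ z1)); rewrite unimod_mul_conj // divff ?n0.
have t0 : 1 + a^-1 + b^-1 + c^-1 = 0.
  rewrite -!inv // -[RHS]conjC0 -[X in _ = X^*]s0 !rmorphD /=.
  by rewrite conjC1.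
have : (1 + a) * (1 + b) * (1 + c) = 0.
  transitivity ((1 + a + b + c) + a * b * c * (1 + a^-1 + b^-1 + c^-1)).
    by field; rewrite !n0.
  by rewrite s0 t0 mulr0 addr0.
move/eqP; rewrite !mulf_eq0 -orbA => /or3P[]; rewrite addrC addr_eq0 => /eqP; by constructor.
Qed.

Lemma four_unimod_cases (h : 'I_4 -> C) : (forall m, `|h m| = 1) -> h 0 = 1 ->
  \sum_m h m = 0 -> exists2 m, m != 0 & h m = -1.
Proof.
move=> h1 h0; rewrite !big_ord_recl big_ord0 /= (_ : ord0 = 0) // h0 addr0 !addrA.
by move=> s0; case: (four_unimod_sum0 (h1 _) (h1 _) (h1 _) s0) => e; eexists; try exact: e.
Qed.

(** * Order four: a row of signs *)

Section Order4.
Variable h : 'I_4 -> 'I_4 -> C.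
Hypothesis h1 : forall i m, `|h i m| = 1.
Hypothesis hort : forall i j, i != j -> \sum_m h i m * (h j m)^* = 0.
Hypothesis hr0 : forall m, h 0 m = 1.
Hypothesis hc0 : forall i, h i 0 = 1.

Let row_sum0 i : i != 0 -> \sum_m h i m = 0.
Proof.
by move=> /hort e; rewrite -[RHS]e; apply: eq_bigr => m _; rewrite hr0 conjC1 mulr1.
Qed.

Let sum4 (F : 'I_4 -> C) i j k : uniq [:: 0 : 'I_4; i; j; k] ->
  \sum_m F m = F 0 + F i + F j + F k.
Proof.
move=> u; rewrite -big_enum (perm_big [:: 0; i; j; k]) /=; last first.
  have sub : {subset [:: 0; i; j; k] <= enum 'I_4} by move=> y; rewrite mem_enum.
  have [_ e] := uniq_min_size u sub (eq_leq (size_enum_ord 4)).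
  by apply: uniq_perm => //; rewrite ?enum_uniq.
by rewrite !big_cons big_nil addr0 !addrA.
Qed.

Let uniq4_ext i j : i != 0 -> j != 0 -> i != j ->
  exists k, uniq [:: 0 : 'I_4; i; j; k].
Proof.
move=> i0 j0 ij.
have /cards1P[k E] : #|~: [set (0 : 'I_4); i; j]| == 1%N.
  by rewrite cardsCs finset.setCK card_ord -finset.setUA !cardsU1 cards1 !inE (eq_sym 0 i)
    (negPf i0)
     (eq_sym 0 j) (negPf j0) (negPf ij).
exists k; have : k \in ~: [set (0 : 'I_4); i; j] by rewrite E !inE eqxx.
rewrite !inE !negb_or -!andbA => /and3P[k0 ki kj] /=.
by rewrite !inE !negb_or (eq_sym 0 i) (eq_sym 0 j) (eq_sym 0 k)
   (eq_sym i k) (eq_sym j k) i0 j0 k0 ij ki kj.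
Qed.

Let opp_pair i m p q : i != 0 -> uniq [:: 0 : 'I_4; m; p; q] -> h i m = -1 ->
  h i q = - h i p.
Proof.
move=> i0 u e; have := row_sum0 i0; rewrite (sum4 _ u) hc0 e subrr add0r addrC.
by move/eqP; rewrite addr_eq0 => /eqP.
Qed.

(** Two nontrivial rows each contain -1. If in different columns, their inner product splits into
    two factors and one of them is a row of signs. If in the same column, they are opposite on the
    last two columns, and orthogonality to both makes the third row a row of signs. *)
Let sign_row : exists i m p q, [/\ i != 0, uniq [:: 0 : 'I_4; m; p; q],
  h i m = 1, h i p = -1 & h i q = -1].
Proof.
have i1 : inord 1 != 0 :> 'I_4 by rewrite -val_eqE /= inordK.
have i2 : inord 2 != 0 :> 'I_4 by rewrite -val_eqE /= inordK.
have i12 : inord 1 != inord 2 :> 'I_4 by rewrite -val_eqE /= !inordK.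
move: (inord 1) (inord 2) i1 i2 i12 => i j i0 j0 ij.
have [m m0 xm] := four_unimod_cases (h1 i) (hc0 i) (row_sum0 i0).
have [p p0 yp] := four_unimod_cases (h1 j) (hc0 j) (row_sum0 j0).
have [k uk] := uniq4_ext i0 j0 ij.
have [k0 ik jk] : [/\ k != 0, k != i & k != j].
  by move: uk; rewrite /= !inE !negb_or (eq_sym 0 k) (eq_sym i k) (eq_sym j k) -!andbA
     => /and5P[_ _ -> _ /and3P[-> -> _]].
have [mp|mp] := eqVneq m p.
  subst p; have [n n0 nm] : exists2 n : 'I_4, n != 0 & m != n.
    by have [->|] := eqVneq m i; [exists j | exists i].
  have [q u] := uniq4_ext m0 n0 nm; exists k, m, n, q.
  have xq := opp_pair i0 u xm; have yq := opp_pair j0 u yp.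
  have xy := hort ij; rewrite (sum4 _ u) !hc0 xm yp xq yq conjC1 !rmorphN /= conjC1 in xy.
  have zx := hort ik; rewrite (sum4 _ u) !hc0 xm xq conjC1 !rmorphN /= conjC1 in zx.
  have zy := hort jk; rewrite (sum4 _ u) !hc0 yp yq conjC1 !rmorphN /= conjC1 in zy.
  have z1 := row_sum0 k0; rewrite (sum4 _ u) hc0 in z1.
  have xn := unimod_mul_conj (h1 i n); have yn := unimod_mul_conj (h1 j n).
  move: xy zx zy z1 xn yn => /=; set x := h i n; set y := h j n.
  set z := h k n; set z' := h k m; set z'' := h k q => xy zx zy z1 xn yn.
  have n2 : 2 != 0 :> C by rewrite pnatr_eq0.
  have sub0 (a b : C) : a - b = 0 -> a = b by move/eqP; rewrite subr_eq0 => /eqP.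
  set XY := (X in X = 0) in xy; set ZX := (X in X = 0) in zx.
  set Z1 := (X in X = 0) in z1.
  have xy1 : x * y^* = -1.
    apply/(mulfI n2)/sub0; transitivity XY; [rewrite /XY; ring | exact: xy].
  have xyE : y = - x.
    apply/sub0; transitivity (y * (1 + x * y^*) + x * (1 - y * y^*)).
      by ring.
    by rewrite xy1 yn; ring.
  rewrite xyE rmorphN /= in zy; set ZY := (X in X = 0) in zy.
  have e1 : z' = 1.
    apply/(mulfI n2)/sub0; transitivity (- (ZX + ZY)); first by rewrite /ZX /ZY; ring.
    by rewrite zx zy addr0 oppr0.
  have e2 : z'' = z.
    apply/sub0; transitivity (- x * ZX + (1 - z') * x + (z'' - z) * (1 - x * x^*)).
      by rewrite /ZX; ring.
    by rewrite zx e1 xn; ring.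
  have e3 : z = -1.
    apply/(mulfI n2)/sub0; transitivity Z1; last exact: z1.
    by rewrite /Z1 e1 e2; ring.
  by rewrite e2 e3 e1.
have [q u] := uniq4_ext m0 p0 mp.
have u' : uniq [:: 0 : 'I_4; p; m; q].
  refine (etrans (perm_uniq _) u); apply/permP => f /=; by do 4!case: (f _).
have xq := opp_pair i0 u xm; have yq := opp_pair j0 u' yp.
have := hort ij; rewrite (sum4 _ u) !hc0 xm yp xq yq conjC1 !rmorphN /= conjC1 /= => xy.
have /eqP : (1 - h i p) * (1 - (h j m)^*) = 0 by rewrite -[RHS]xy; ring.
rewrite mulf_eq0 => /orP[]; rewrite subr_eq0 eq_sym.
  move/eqP => e; exists i, p, m, q; split => //.
  by rewrite xq e.
rewrite -[X in _ == X]conjC1 (can_eq conjCK) => /eqP e; exists j, m, p, q; split => //.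
by rewrite yq e.
Qed.

Lemma hadamard4_rows : exists i l m p q, [/\ uniq [:: 0 : 'I_4; m; p; q],
  [/\ h i m = 1, h i p = -1 & h i q = -1], h l m = -1 & h l q = - h l p].
Proof.
have [i [m [p [q [i0 u im ip iq]]]]] := sign_row.
have [l l0 li] : exists2 l : 'I_4, l != 0 & l != i.
  have [->|] := eqVneq i (inord 1).
    by exists (inord 2); rewrite -val_eqE /= ?inordK.
  by exists (inord 1); [rewrite -val_eqE /= inordK | rewrite eq_sym].
exists i, l, m, p, q; have s := row_sum0 l0; have o := hort li.
rewrite (sum4 _ u) hc0 in s; rewrite (sum4 _ u) !hc0 im ip iq rmorphN /= !conjC1 in o.
have n2 : 2 != 0 :> C by rewrite pnatr_eq0.
have e : h l m = -1.
  apply: (mulfI n2); apply/eqP; rewrite -subr_eq0; apply/eqP.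
  (* Adding the row sum to the inner product with the row of signs cancels the entries at [p] and
     [q], leaving [2 + 2 * h l m]. *)
  transitivity ((1 + h l m + h l p + h l q) + (1 * 1 + h l m * 1 + h l p * -1 + h l q * -1)).
    by ring.
  by rewrite s o addr0.
split=> //; apply/eqP; rewrite -subr_eq0; apply/eqP.
transitivity (1 + h l m + h l p + h l q); last exact: s.
by rewrite e; ring.
Qed.

End Order4.

(** The powers of [r m / r a] with exponent below [n] sum to [n] or 0 according to whether
    [r m = r a]. Summed over [m], only exponent 0 survives and gives [n]: the value [r a] is taken
    once. *)
Lemma unity_roots_inj n (r : 'I_n -> C) : (forall m, r m ^+ n = 1) ->
  (forall k, (0 < k < n)%N -> \sum_m r m ^+ k = 0) -> injective r.
Proof.
move=> rn rk a b rab; apply/eqP; case: (eqVneq a b) => // nab.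
have n0 : (0 < n)%N by exact: leq_ltn_trans (ltn_ord a).
have r0 m : r m != 0.
  by apply/eqP => e; move: (rn m); rewrite e expr0n gtn_eqF // => /esym/eqP; rewrite oner_eq0.
have geo m : \sum_(k < n) (r m / r a) ^+ k = n%:R * (r m == r a)%:R.
  case: eqVneq => [->|ne].
    rewrite divff // (eq_bigr (fun=> 1)) ?sumr_const ?card_ord ?mulr1 // => k _.
    by rewrite expr1n.
  have zn0 : r m / r a - 1 != 0.
    by rewrite subr_eq0; apply: contra ne => /eqP e; rewrite -[r m](divfK (r0 a)) e mul1r.
  by apply: (mulfI zn0); rewrite -subrX1 expr_div_n !rn divr1 subrr !mulr0.
have : \sum_m \sum_(k < n) (r m / r a) ^+ k = n%:R.
  rewrite exchange_big (bigD1 (Ordinal n0)) //= [X in _ + X]big1 ?addr0.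
    by rewrite (eq_bigr (fun=> 1)) ?sumr_const ?card_ord.
  move=> k k0; rewrite (eq_bigr (fun m => r m ^+ k * (r a)^-1 ^+ k)).
    by rewrite -mulr_suml rk ?mul0r // ltn_ord andbT lt0n.
  by move=> m _; rewrite exprMn.
rewrite (eq_bigr _ (fun m _ => geo m)) -mulr_sumr -natr_sum -natrM => /eqP.
rewrite eqr_nat (bigD1 a) //= (bigD1 b) ?(eq_sym b) //= -rab eqxx.
by move: (\sum_(_ | _) _)%N => N; rewrite mulnDr muln1 addnC; lia.
Qed.

(** The double quotient is kept explicit: when row [i] holds the values of a character on points
    [a m], it is the value of the character quotient of rows [i] and 0 at [a m - a 0]. *)
Lemma dephase n (H : 'I_n.+1 -> 'I_n.+1 -> C) : (forall i m, `|H i m| = 1) ->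
  (forall i j, i != j -> \sum_m H i m * (H j m)^* = 0) ->
  let h i m := (H i m * (H i 0)^*) * (H 0 m * (H 0 0)^*)^* in
  [/\ forall i m, `|h i m| = 1, forall i j, i != j -> \sum_m h i m * (h j m)^* = 0,
      forall m, h 0 m = 1 & forall i, h i 0 = 1].
Proof.
move=> H1 Ho h.
have HH i m := unimod_mul_conj (H1 i m).
split=> [i m|i j ij|m|i].
- by rewrite /h !(normrM, norm_conjC) !H1 !mulr1.
- rewrite -[RHS](mul0r ((H i 0)^* * H j 0)) -[X in _ = X * _](Ho i j ij) mulr_suml.
  apply: eq_bigr => m _; rewrite /h !rmorphM /= !conjCK.
  rewrite -[RHS]mulr1 -(HH 0 m) -[RHS]mulr1 -(HH 0 0); ring.
- by rewrite /h unimod_mul_conj // normrM norm_conjC !H1 mulr1.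
- by rewrite /h !HH conjC1 mulr1.
Qed.

Lemma hadamard5 (H : 'I_5 -> 'I_5 -> C) : (forall i m, `|H i m| = 1) ->
  (forall i j, i != j -> \sum_m H i m * (H j m)^* = 0) ->
  exists i j, let r m := (H i m * (H i 0)^*) * (H j m * (H j 0)^*)^* in
    injective r /\ forall m, r m ^+ 5 = 1.
Proof.
move=> H1 Ho; have [h1 hort hr0 hc0] := dephase H1 Ho.
have [p p0 s2] := hadamard5_row h1 hort hr0 hc0.
exists p, 0 => r; have s1 : \sum_m r m = 0.
  by rewrite -[RHS](hort _ _ p0); apply: eq_bigr => m _; rewrite hr0 conjC1 mulr1.
have r1 m : `|r m| = 1 by exact: h1.
have r5 m : r m ^+ 5 = 1.
  by apply: etrans (five_unimod_pow5 r1 s1 s2 m 0) _; rewrite [r 0]hc0 expr1n.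
(* Since [r m ^+ 5 = 1], conjugation exchanges the exponents [k] and [5 - k], so power sums 1 and 2
   also settle 4 and 3. *)
split=> //; have compl k k' : (k + k' = 5)%N ->
    \sum_m r m ^+ k = 0 -> \sum_m r m ^+ k' = 0.
  move=> kk' e; rewrite -[RHS]conjC0 -[X in _ = X^*]e rmorph_sum; apply: eq_bigr => m _.
  have rk1 : `|r m ^+ k| = 1 by rewrite normrX r1 expr1n.
  have rk0 : r m ^+ k != 0 by rewrite -normr_eq0 rk1 oner_eq0.
  by apply: (mulfI rk0); rewrite /= (unimod_mul_conj rk1) -exprD kk' r5.
apply: (unity_roots_inj r5) => -[|[|[|[|[|//]]]]] // _.
- exact: (compl 2%N).
- exact: (compl 1%N).
Qed.

Lemma hadamard4 (H : 'I_4 -> 'I_4 -> C) : (forall i m, `|H i m| = 1) ->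
  (forall i j, i != j -> \sum_m H i m * (H j m)^* = 0) ->
  exists j i l m p q, let r i m := (H i m * (H i 0)^*) * (H j m * (H j 0)^*)^* in
  [/\ uniq [:: 0 : 'I_4; m; p; q],
  [/\ r i m = 1, r i p = -1 & r i q = -1], r l m = -1 & r l q = - r l p].
Proof.
move=> H1 Ho; have [h1 hort hr0 hc0] := dephase H1 Ho.
by exists 0; exact: hadamard4_rows h1 hort hr0 hc0.
Qed.

Lemma hadamard3 (H : 'I_3 -> 'I_3 -> C) : (forall i m, `|H i m| = 1) ->
  (forall i j, i != j -> \sum_m H i m * (H j m)^* = 0) ->
  exists i j, let r m := (H i m * (H i 0)^*) * (H j m * (H j 0)^*)^* in
    injective r /\ forall m, r m ^+ 3 = 1.
Proof.
move=> H1 Ho; have [h1 hort hr0 hc0] := dephase H1 Ho.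
have i0 : inord 1 != 0 :> 'I_3 by rewrite -val_eqE /= inordK.
exists (inord 1), 0 => r; have s1 : \sum_m r m = 0.
  by rewrite -[RHS](hort _ _ i0); apply: eq_bigr => m _; rewrite hr0 conjC1 mulr1.
have r1 m : `|r m| = 1 by exact: h1.
have r0 m : r m != 0 by rewrite -normr_eq0 r1 oner_eq0.
have inv m : (r m)^* = (r m)^-1.
  by apply: (mulfI (r0 m)); rewrite unimod_mul_conj // divff.
have t1 : \sum_m (r m)^-1 = 0.
  by rewrite -[RHS]conjC0 -[X in _ = X^*]s1 rmorph_sum; apply: eq_bigr => m _; exact/esym/inv.
have E m : r m ^+ 3 = \prod_k r k.
  have : \prod_k (r m - r k) = 0 by rewrite (bigD1 m) //= subrr mul0r.
  move: (r m) => t; move: s1 t1; rewrite !big_ord_recl !big_ord0 !addr0 !mulr1.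
  move: (r _) (r0 ord0) => a a0; move: (r _) (r0 (lift ord0 ord0)) => b b0.
  move: (r _) (r0 (lift ord0 (lift ord0 ord0))) => c c0 S T P.
  rewrite -[LHS]subr0 -P.
  (* The second symmetric function is [a b c] times the sum of the inverses, zero by conjugation;
     only the product of the roots remains. *)
  transitivity ((a + (b + c)) * t ^+ 2 - a * b * c * (a^-1 + (b^-1 + c^-1)) * t + a * (b * c)).
    by field; rewrite a0 b0 c0.
  by rewrite S T; ring.
have r3 m : r m ^+ 3 = 1.
  have r00 : r 0 = 1 by exact: hc0.
  by rewrite E -(E 0) r00 expr1n.
split=> //; apply: (unity_roots_inj r3) => -[|[|[|//]]] // _.
rewrite -[RHS]t1; apply: eq_bigr => m _.
by apply: (mulfI (r0 m)); rewrite divff // -exprS r3.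
Qed.

Lemma hadamard2 (H : 'I_2 -> 'I_2 -> C) : (forall i m, `|H i m| = 1) ->
  (forall i j, i != j -> \sum_m H i m * (H j m)^* = 0) ->
  exists i j, let r m := (H i m * (H i 0)^*) * (H j m * (H j 0)^*)^* in
    injective r /\ forall m, r m ^+ 2 = 1.
Proof.
move=> H1 Ho; have [h1 hort hr0 hc0] := dephase H1 Ho.
have i0 : 1 != 0 :> 'I_2 by [].
exists 1, 0 => r; have s1 : \sum_m r m = 0.
  by rewrite -[RHS](hort _ _ i0); apply: eq_bigr => m _; rewrite hr0 conjC1 mulr1.
have r2 m : r m ^+ 2 = 1.
  have rN : r (lift ord0 ord0) = - r 0.
    by move: s1; rewrite !big_ord_recl !big_ord0 addr0 addrC => /eqP; rewrite addr_eq0 => /eqP.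
  have r0 : r 0 = 1 by exact: hc0.
  suff : m = 0 \/ m = lift ord0 ord0 by case=> ->; rewrite ?rN ?sqrrN r0 expr1n.
  by case: m => [[|[|//]] ?]; [left|right]; exact/val_inj.
by split=> //; apply: (unity_roots_inj r2) => -[|[|//]].
Qed.
End HadamardMatrices.

(** * Tilings of a group from characters *)

Section UnitCircle.
Variable R : realType.
Implicit Types s t : R.

Definition expi2pi t : R[i] := Complex (cos (2 * pi * t)) (sin (2 * pi * t)).

Lemma expi2piD s t : expi2pi (s + t) = expi2pi s * expi2pi t.
Proof. by rewrite /expi2pi mulrDr cosD sinD [X in Complex _ X]addrC. Qed.

Lemma expi2pi0 : expi2pi 0 = 1.
Proof. by rewrite /expi2pi mulr0 cos0 sin0. Qed.

Lemma norm_expi2pi t : `|expi2pi t| = 1.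
Proof. by rewrite normc_def /= cos2Dsin2 sqrtr1. Qed.

Lemma expi2pi_neq0 t : expi2pi t != 0.
Proof. by rewrite -normr_eq0 norm_expi2pi oner_eq0. Qed.

Lemma conj_expi2pi t : (expi2pi t)^* = expi2pi (- t).
Proof.
apply: (mulfI (expi2pi_neq0 t)).
by rewrite unimod_mul_conj ?norm_expi2pi // -expi2piD subrr expi2pi0.
Qed.

Lemma expi2piX t n : expi2pi t ^+ n = expi2pi (n%:R * t).
Proof.
elim: n => [|n IH]; first by rewrite mul0r expi2pi0.
by rewrite exprS IH -expi2piD -natr1 mulrDl mul1r addrC.
Qed.

Lemma expi2pi1 : expi2pi 1 = 1.
Proof. by rewrite /expi2pi mulr1 mulr_natl cos2pi sin2pi. Qed.

Lemma expi2pi_half : expi2pi 2^-1 = -1.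
Proof. by rewrite /expi2pi mulrAC divff // mul1r cospi sinpi; congr Complex;
  rewrite oppr0. Qed.

Lemma expi2pi_int (m : int) : expi2pi m%:~R = 1.
Proof.
case: m => n.
  by rewrite -[_%:~R]mulr1 -[n%:~R]/(n%:R) -expi2piX expi2pi1 expr1n.
rewrite NegzE mulrNz -conj_expi2pi -[_%:~R]mulr1 -[_%:~R]/(n.+1%:R) -expi2piX expi2pi1.
by rewrite expr1n conjC1.
Qed.

Lemma expi2pi_eq1 t : expi2pi t = 1 -> exists m : int, t = m%:~R.
Proof.
move=> e1; exists (Num.floor t).
have := floor_itv t; set m := Num.floor t => /andP[lem ltm].
pose s := t - m%:~R; have s0 : 0 <= s by rewrite subr_ge0.
have s1 : s < 1 by rewrite /s ltrBlDr -[1]/(1%:~R) -intrD addrC.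
have es : expi2pi s = 1 by rewrite /s expi2piD e1 mul1r -mulrNz expi2pi_int.
have [cs ss] : cos (2 * pi * s) = 1 /\ sin (2 * pi * s) = 0 by case: es.
suff : s = 0 by move/eqP; rewrite subr_eq0 => /eqP.
have pi0 := pi_gt0 R.
apply/eqP; rewrite eq_le s0 andbT leNgt; apply/negP => sp.
(* The sine is positive before the half turn and negative after it; at the half turn the exponential
   is -1. *)
have [lt|gt|eq] := ltgtP s 2^-1.
- have : 0 < sin (2 * pi * s).
    by apply: sin_gt0_pi; apply/andP; split; nra.
  by rewrite ss ltxx.
- have : 0 < sin (2 * pi * s - pi).
    by apply: sin_gt0_pi; apply/andP; split; nra.
  by rewrite sinB ss cospi sinpi !(mulr0, mul0r, subr0) ltxx.
- move: es; rewrite eq expi2pi_half => /eqP.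
  by rewrite eqNr oner_eq0.
Qed.

Lemma expi2pi_eqN1 t : expi2pi t = -1 -> exists m : int, 2 * t = (2 * m + 1)%:~R.
Proof.
move=> e; have /expi2pi_eq1[m mE] : expi2pi (t - 2^-1) = 1.
  by rewrite expi2piD -conj_expi2pi expi2pi_half e rmorphN /= conjC1 mulrNN mulr1.
exists m; rewrite -[t](subrK 2^-1) mE intrD intrM mulrDr divff //.
Qed.

End UnitCircle.

(* [c] is the indicator of a set [T] such that the translates [a k + T] partition [V]. *)
Definition tile_code (V : zmodType) n (a : 'I_n -> V) (c : V -> bool) :=
  forall x, exists2 k, c (x - a k) & forall l, c (x - a l) -> l = k.

Section Codes.
Variables (R : realType) (V : zmodType).
Implicit Type psi : V -> R.

Lemma floor_sub_int t (m : int) : Num.floor (t - m%:~R : R) = Num.floor t - m.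
Proof. by rewrite floorDrz ?rpredN ?intr_int // floorN ?intr_int // intrKfloor. Qed.

(* The k-th translate consists of the x with floor (n psi(x - a 0)) = m_k mod n. *)
Lemma cyclic_tile_code n (a : 'I_n.+1 -> V) psi : {morph psi : x y / x - y} ->
  injective (fun k => expi2pi (psi (a k) - psi (a 0))) ->
  (forall k, expi2pi (psi (a k) - psi (a 0)) ^+ n.+1 = 1) ->
  exists c, tile_code a c.
Proof.
move=> psiB inj pow.
have /choice[m mE] k : exists m : int, n.+1%:R * (psi (a k) - psi (a 0)) = m%:~R.
  by apply: expi2pi_eq1; rewrite -expi2piX.
have fE x k : Num.floor (n.+1%:R * psi (x - a k)) =
    Num.floor (n.+1%:R * psi (x - a 0)) - m k.
  rewrite -floor_sub_int -mE; congr Num.floor; rewrite !psiB; ring.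
pose N : int := n.+1; have N0 : N != 0 by [].
have lt k : (`|(m k %% N)%Z| < n.+1)%N.
  by rewrite -ltz_nat gez0_abs ?modz_ge0 // ltz_pmod.
pose g k : 'I_n.+1 := Ordinal (lt k).
have gP k l : (g k == g l) = (m k == m l %[mod N])%Z.
  rewrite -val_eqE /= -eqz_nat !gez0_abs ?modz_ge0 //.
(* Congruent [m k] and [m l] make [psi (a k)] and [psi (a l)] differ by an integer. Being injective
   on a finite type, [g] is onto, so each residue selects exactly one [k]. *)
have ginj : injective g.
  move=> k l /eqP; rewrite gP eqz_mod_dvd => /dvdzP[q qE]; apply: inj => /=.
  have -> : psi (a k) - psi (a 0) = (psi (a l) - psi (a 0)) + q%:~R.
    apply: (@mulfI _ n.+1%:R); first by rewrite pnatr_eq0.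
    by rewrite [RHS]mulrDr !mE -[m k](subrK (m l)) qE intrD intrM addrC mulrC.
  by rewrite expi2piD expi2pi_int mulr1.
exists (fun x => (N %| Num.floor (n.+1%:R * psi x))%Z) => x.
set F := Num.floor (n.+1%:R * psi (x - a 0)) in fE *.
have ltF : (`|(F %% N)%Z| < n.+1)%N by rewrite -ltz_nat gez0_abs ?modz_ge0 // ltz_pmod.
have gF k : (N %| Num.floor (n.+1%:R * psi (x - a k)))%Z = (g k == Ordinal ltF).
  by rewrite fE -eqz_mod_dvd -val_eqE /= -eqz_nat !gez0_abs ?modz_ge0 // eq_sym.
have /codomP[k kE] : Ordinal ltF \in codom g by rewrite (inj_card_onto ginj).
exists k; first by rewrite gF -kE.
by move=> l; rewrite gF kE => /eqP/ginj.
Qed.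

(* [chi] splits the indices into the pairs [{0, m}] and [{p, q}], and [psi] separates
   the elements of each pair. *)
Lemma klein_tile_code (a : 'I_4 -> V) (chi psi : V -> R) m p q :
  {morph chi : x y / x - y} -> {morph psi : x y / x - y} ->
  uniq [:: 0 : 'I_4; m; p; q] ->
  expi2pi (chi (a m) - chi (a 0)) = 1 -> expi2pi (chi (a p) - chi (a 0)) = -1 ->
  expi2pi (chi (a q) - chi (a 0)) = -1 ->
  expi2pi (psi (a m) - psi (a 0)) = -1 ->
  expi2pi (psi (a q) - psi (a 0)) = - expi2pi (psi (a p) - psi (a 0)) ->
  exists c, tile_code a c.
Proof.
move=> chiB psiB u cm cp cq pm pqp.
have pq : expi2pi (psi (a q) - psi (a p)) = -1.
  have -> : psi (a q) - psi (a p) = (psi (a q) - psi (a 0)) + - (psi (a p) - psi (a 0)).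
    by ring.
  by rewrite expi2piD pqp -conj_expi2pi mulNr unimod_mul_conj ?norm_expi2pi.
(* This bit tells which half of the circle contains the value of the character; a factor -1 flips
   it. *)
pose par (phi : V -> R) x := ~~ (2 %| Num.floor (2 * phi x))%Z.
have parE phi x k l (b : bool) : {morph phi : x y / x - y} ->
    expi2pi (phi (a k) - phi (a l)) = (-1) ^+ b ->
    par phi (x - a k) = b (+) par phi (x - a l).
  move=> phiB e.
  have [z zE] : exists z : int, 2 * (phi (a k) - phi (a l)) = (2 * z + (b : nat)%:Z)%:~R.
    case: b e => e.
      by have [z ->] := expi2pi_eqN1 e; exists z.
    by have [z ->] := expi2pi_eq1 e; exists z; rewrite addr0 intrM.
  rewrite /par.
  have -> : 2 * phi (x - a k) = 2 * phi (x - a l) - (2 * z + (b : nat)%:Z)%:~R.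
    by rewrite -zE !phiB; ring.
  rewrite floor_sub_int; move: (Num.floor _) => F.
  by case: b {e zE} => /=; lia.
have E0 phi x k l : {morph phi : x y / x - y} -> expi2pi (phi (a k) - phi (a l)) = 1 ->
    par phi (x - a k) = par phi (x - a l).
  by move=> phiB e; rewrite (@parE _ _ k l false).
have E1 phi x k l : {morph phi : x y / x - y} -> expi2pi (phi (a k) - phi (a l)) = -1 ->
    par phi (x - a k) = ~~ par phi (x - a l).
  by move=> phiB e; rewrite (@parE _ _ k l true).
exists (fun x => par chi x && par psi x) => x.
have c1 := E0 _ x _ _ chiB cm; have c2 := E1 _ x _ _ chiB cp.
have c3 := E1 _ x _ _ chiB cq; have p1 := E1 _ x _ _ psiB pm; have p2 := E1 _ x _ _ psiB pq.
have all4 l : l \in [:: 0 : 'I_4; m; p; q].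
  have sub : {subset [:: 0; m; p; q] <= enum 'I_4} by move=> y; rewrite mem_enum.
  by have [_ ->] := uniq_min_size u sub (eq_leq (size_enum_ord 4)); rewrite mem_enum.
have [k kin kE] : exists2 k, k \in [:: 0 : 'I_4; m; p; q] &
    forall l, l \in [:: 0 : 'I_4; m; p;
      q] -> (par chi (x - a l) && par psi (x - a l)) = (l == k).
  move: u; rewrite /= !inE !negb_or -!andbA => /and5P[m0 p0 q0 mp /and3P[mq ppq _]].
  exists (if par chi (x - a 0) then if par psi (x - a 0) then 0 else m
          else if par psi (x - a p) then p else q).
    by case: ifP => _; case: ifP => _; rewrite !inE eqxx ?orbT.
  move=> l; rewrite !inE => /or4P[] /eqP ->; rewrite ?(c1, c2, c3, p1, p2);
  case: (par chi (x - a 0)); case: (par psi (x - a 0)); case: (par psi (x - a p));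
  by rewrite /= ?eqxx // ?(negPf m0) ?(negPf p0) ?(negPf q0) ?(negPf mp) ?(negPf mq)
     ?(negPf ppq) // eq_sym ?(negPf m0) ?(negPf p0) ?(negPf q0) ?(negPf mp) ?(negPf mq)
     ?(negPf ppq).
exists k; first by rewrite kE ?eqxx.
by move=> l; rewrite kE // => /eqP.
Qed.

(** Characters come as real lifts [phi i] because the codes are cut out by [Num.floor]. One
    difference of lifts suffices in orders two, three and five; order four needs two. *)
Lemma spectral_tile_code n (a : 'I_n.+1 -> V) (phi : 'I_n.+1 -> V -> R) :
  (n.+1 <= 5)%N -> (forall i, {morph phi i : x y / x - y}) ->
  (forall i j, i != j -> \sum_k expi2pi (phi i (a k) - phi j (a k)) = 0) ->
  exists c, tile_code a c.
Proof.
move=> n5 phiB ort.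
pose H i k := expi2pi (phi i (a k)).
have H1 i k : `|H i k| = 1 by exact: norm_expi2pi.
have Ho i j : i != j -> \sum_k H i k * (H j k)^* = 0.
  by move=> /ort e; rewrite -[RHS]e; apply: eq_bigr => k _; rewrite conj_expi2pi -expi2piD.
pose psi i j x := phi i x - phi j x.
have psiB i j : {morph psi i j : x y / x - y} by move=> x y; rewrite /psi !phiB; ring.
have rE i j m : (H i m * (H i 0)^*) * (H j m * (H j 0)^*)^* =
    expi2pi (psi i j (a m) - psi i j (a 0)).
  rewrite !conj_expi2pi -!expi2piD conj_expi2pi -expi2piD; congr expi2pi; rewrite /psi; ring.
have cyc i j : let r m := (H i m * (H i 0)^*) * (H j m * (H j 0)^*)^* in
    injective r -> (forall m, r m ^+ n.+1 = 1) -> exists c, tile_code a c.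
  move=> r rinj rn; apply: (cyclic_tile_code (psiB i j)) => [k l|k].
    by rewrite -!rE => /rinj.
  by rewrite -rE; exact: rn.
case: n n5 a phi phiB ort H H1 Ho psi psiB rE cyc =>
  [|[|[|[|[|//]]]]] _ a phi phiB ort H H1 Ho psi psiB rE cyc.
- apply: (cyclic_tile_code (phiB 0)) => [k l _|k]; first by rewrite !ord1.
  by rewrite ord1 subrr expi2pi0 expr1n.
- by have [i [j [rinj rn]]] := hadamard2 H1 Ho; exact: cyc rinj rn.
- by have [i [j [rinj rn]]] := hadamard3 H1 Ho; exact: cyc rinj rn.
- have [j [i [l [m [p [q [u [im ip iq] lm lqp]]]]]]] := hadamard4 H1 Ho.
  apply: (klein_tile_code (psiB i j) (psiB l j) u); rewrite -?rE //.
- by have [i [j [rinj rn]]] := hadamard5 H1 Ho; exact: cyc rinj rn.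
Qed.

End Codes.

(** * Integer parts, and the passage from tilings of Z^d to R^d *)

Section Coordinates.
Variable R : realType.

Fixpoint of_coord (d : nat) (f : nat -> R) : Rd R d :=
  match d with
  | 0 => tt
  | n.+1 => (f 0%N, of_coord n (f \o S))
  end.

Lemma rcoord_of_coord d f i : (i < d)%N -> rcoord (of_coord d f) i = f i.
Proof. by elim: d f i => // d IH f [|i] //= id; rewrite IH. Qed.

Lemma rcoord_rsub d (x y : Rd R d) i : rcoord (rsub x y) i = rcoord x i - rcoord y i.
Proof. by elim: d x y i => [|d IH] x y [|i] //=; rewrite ?subr0. Qed.

Definition of_int d (z : 'rV[int]_d) : Rd R d :=
  of_coord d (fun i => (if insub i is Some j then z ord0 j else 0)%:~R).

Lemma rcoord_of_int d (z : 'rV[int]_d) (i : 'I_d) : rcoord (of_int z) i = (z ord0 i)%:~R.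
Proof. by rewrite rcoord_of_coord // valK. Qed.

Definition floorv d (x : Rd R d) : 'rV[int]_d := \row_i Num.floor (rcoord x i).

Lemma cube_unionE d (A : {fset 'rV[int]_d}) (x : Rd R d) :
  cube_union A x <-> floorv x \in A.
Proof.
split=> [[a aA xa]|fA].
  suff -> : floorv x = a by [].
  apply/rowP => i; rewrite !mxE; apply/eqP; rewrite floor_eq.
  by rewrite intrD; exact: xa.
exists (floorv x) => // i; rewrite !mxE -[1]/(1%:~R) -intrD; exact: floor_itv.
Qed.

Lemma floorv_rsub_of_int d (x : Rd R d) z : floorv (rsub x (of_int z)) = floorv x - z.
Proof.
apply/rowP => i; rewrite !mxE rcoord_rsub rcoord_of_int; exact: floor_sub_int.
Qed.

(** As the cubes are half open, [x - z] lies in Omega exactly when [floorv x - z] is in [A]; the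
    covering multiplicity is 1 at every point. *)
Lemma tile_code_tiles d (A : {fset 'rV[int]_d}) n (a : 'I_n -> 'rV[int]_d) c :
  (forall x, x \in A <-> exists k, x = a k) -> tile_code a c -> tiles (@cube_union R d A).
Proof.
move=> aA ac; exists [set of_int z | z in [set z | c z]].
apply: aeW => x.
have [k ck kuniq] := ac (floorv x).
pose t0 := of_int (floorv x - a k).
rewrite (esumID [set t0]) => [|t _]; last by rewrite lee_fin.
rewrite [X in (X + _)%E = _](_ : _ = 1%E); last first.
  rewrite setIidr => [|t ->]; last by exists (floorv x - a k).
  rewrite esum_set1 ?lee_fin // indicE mem_set //.
  apply/cube_unionE; rewrite floorv_rsub_of_int opprB addrC subrK; apply/aA; by exists k.
rewrite esum1 ?adde0 // => _ [[z cz <-] zt0]; rewrite indicE memNset //.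
move/cube_unionE; rewrite floorv_rsub_of_int => /aA[l lE]; apply: zt0.
have zE : z = floorv x - a l by rewrite -lE opprB addrC subrK.
by rewrite /t0 /= -(kuniq l) -?zE.
Qed.

End Coordinates.

(** * Fourier transforms of unit cubes *)

Lemma integral_setX (R : realType) d1 d2 (T1 : measurableType d1) (T2 : measurableType d2)
    (m1 : {sigma_finite_measure set T1 -> \bar R})
    (m2 : {sigma_finite_measure set T2 -> \bar R})
    (A : set T1) (B : set T2) (f : T1 * T2 -> \bar R) :
  measurable A -> measurable B -> (m1 \x m2)%E.-integrable (A `*` B) f ->
  (\int[(m1 \x m2)]_(z in A `*` B) f z = \int[m1]_(x in A) \int[m2]_(y in B) f (x, y))%E.
Proof.
move=> mA mB fi; have mAB : measurable (A `*` B) by exact: measurableX.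
rewrite integral_mkcond -integral12_prod_meas1; last exact/(integrable_mkcond _ mAB).
rewrite [RHS]integral_mkcond; apply: eq_integral => x _; rewrite /fubini_F patchE.
case: ifPn => [|] xA; first rewrite inE in xA.
  rewrite [RHS]integral_mkcond; apply: eq_integral => y _; rewrite !patchE.
  rewrite (_ : ((x, y) \in _) = (y \in B)) //.
  by apply/idP/idP => [/set_mem[_ yB]|/set_mem yB]; exact/mem_set.
rewrite integral0_eq // => y _; rewrite patchE ifF //; apply/negP; rewrite inE => -[].
by move=> /= xA'; move: xA; rewrite notin_setE.
Qed.

Lemma cos_integrable (R : realType) d (T : measurableType d)
    (mu : {measure set T -> \bar R}) (D : set T) (f : T -> R) : measurable D ->
  (mu D < +oo)%E -> measurable_fun setT f -> mu.-integrable D (fun x => (cos (f x))%:E).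
Proof.
move=> mD finD mf; apply: measurable_bounded_integrable => //.
  apply: measurable_funTS; apply: measurableT_comp => //.
  exact: (continuous_measurable_fun (@continuous_cos R)).
by exists 1; split => // M M1 x _ /=; exact: le_trans (cos_max _) (ltW M1).
Qed.

Section Sinc.
Variable R : realType.
Implicit Types t xi c a : R.

Lemma unit_itvE a : [set t | a <= t < a + 1] = [set` `[a, a + 1[%R].
Proof. by apply/seteqP; split => t /=; rewrite in_itv. Qed.

Lemma lebesgue_measure_unit_itv a :
  lebesgue_measure [set t : R | (a <= t < a + 1)%R] = 1%E.
Proof.
rewrite unit_itvE lebesgue_measure_itv /= lte_fin ltrDl ltr01.
by rewrite -EFinD addrAC subrr add0r.
Qed.

(** The Fourier transform of a unit interval up to phase. It is 1 at 0, where the quotient would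
    evaluate to 0. *)
Definition sinc xi : R := if xi == 0 then 1 else sin (pi * xi) / (pi * xi).

(** The free phase [c] serves twice: it absorbs a coordinate held fixed in the induction on the
    dimension, and [c = - (pi / 2)] turns cosines into sines. *)
Lemma integral_cos_itv c xi a :
  (\int[lebesgue_measure]_(t in [set t | (a <= t < a + 1)%R]) (cos (c + 2 * pi * (xi *
    t)))%:E =
   (cos (c + 2 * pi * (xi * (a + 2^-1))) * sinc xi)%:E)%E.
Proof.
rewrite unit_itvE.
pose g t := cos (c + 2 * pi * (xi * t)).
have lin t : is_derive t (1 : R) (fun t => c + 2 * pi * (xi * t)) (2 * pi * xi).
  have -> : (fun t => c + 2 * pi * (xi * t)) = cst c + ((2 * pi * xi) \*: (id : R -> R)).
    by apply/funext => u; rewrite mulrA.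
  apply: is_derive_eq; rewrite add0r; exact: mulr1.
have cg : continuous g.
  move=> t; apply: continuous_comp; last exact: continuous_cos.
  by apply/differentiable_continuous/derivable1_diffP; have [] := lin t.
rewrite integral_itv_bndo_bndc; last first.
  apply/measurable_EFinP; apply: measurable_funTS; exact: continuous_measurable_fun.
have ab : a < a + 1 by rewrite ltrDl.
have pi0 := pi_gt0 R.
rewrite /sinc; case: eqVneq => [->|xi0].
  under eq_integral do rewrite mul0r mulr0 addr0.
  rewrite integral_cst //= lebesgue_measure_itv /= lte_fin ab mul0r mulr0 addr0 mulr1.
  by rewrite -EFinD addrAC subrr add0r mule1.
pose F t := (2 * pi * xi)^-1 * sin (c + 2 * pi * (xi * t)).
have k0 : 2 * pi * xi != 0 by rewrite !mulf_neq0 // gt_eqF.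
have dF t : is_derive t (1 : R) F (g t).
  have -> : F = (2 * pi * xi)^-1 \*: (sin \o (fun t => c + 2 * pi * (xi * t))).
    by apply/funext.
  apply: is_derive_eq; rewrite /g /GRing.scale /=; move: (pi : R) pi0 {k0 F} => p p0; field.
  by rewrite xi0 gt_eqF.
have cF : continuous F.
  by move=> t; apply/differentiable_continuous/derivable1_diffP; have [] := dF t.
rewrite (@continuous_FTC2 _ g F) //.
- rewrite -EFinB /F; congr EFin; move: (pi : R) pi0 {k0 F dF cF g lin cg} => p p0.
  (* The phase at the midpoint; at the endpoints it is [m + p * xi] and [m - p * xi]. *)
  pose m := c + 2 * p * (xi * (a + 2^-1)).
  transitivity ((2 * p * xi)^-1 * sin (m + p * xi) - (2 * p * xi)^-1 * sin (m - p * xi)).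
    by congr (_ * sin _ - _ * sin _); rewrite /m; field.
  by rewrite sinD sinB -/m; field; rewrite xi0 gt_eqF.
- exact: continuous_subspaceT.
- split; first by move=> t _; have [] := dF t.
  + exact/cvg_at_right_filter/cF.
  + exact/cvg_at_left_filter/cF.
- by move=> t _; rewrite derive1E; have [] := dF t.
Qed.

End Sinc.

Section Cubes.
Variable R : realType.

Definition cube d (a : nat -> R) : set (Rd R d) :=
  [set x | forall i, (i < d)%N -> a i <= rcoord x i < a i + 1].

Lemma cubeS d a :
  @cube d.+1 a = [set t : R | a 0%N <= t < a 0%N + 1] `*` cube (fun i => a i.+1).
Proof.
apply/seteqP; split=> [[t x] xa|[t x] [ta xa] [|i] id //].
  by split=> [|i id]; [exact: (xa 0%N)|exact: (xa i.+1)].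
exact: xa.
Qed.

Lemma measurable_rcoord d i : measurable_fun setT (fun x : Rd R d => rcoord x i).
Proof.
elim: d i => [|d IH] [|i] //=; first exact: measurable_fst.
exact: (measurableT_comp (IH i) (@measurable_snd _ _ _ _)).
Qed.

Lemma measurable_rdot d (l : Rd R d) : measurable_fun setT (rdot l).
Proof.
apply: measurable_sum => i; apply: measurable_funM => //; exact: measurable_rcoord.
Qed.

Lemma cube_measure d a : measurable (@cube d a) /\ leb R d (cube a) = 1%E.
Proof.
elim: d a => [|d IH] a.
  have -> : @cube 0 a = setT by rewrite predeqE => x; split.
  by split; [exact: measurableT|rewrite /leb /= diracT].
have [mc lc] := IH (fun i => a i.+1).
have mi : measurable [set t : R | a 0%N <= t < a 0%N + 1].
  by rewrite unit_itvE.
rewrite cubeS; split; first exact: measurableX.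
rewrite /leb /= /lprod product_measure1E // [X in (_ * X)%E]lc mule1.
exact: lebesgue_measure_unit_itv.
Qed.

Lemma integral_cos_cube d (l : Rd R d) c a :
  (\int[leb R d]_(x in cube a) (cos (c + 2 * pi * rdot l x))%:E =
   (cos (c + 2 * pi * \sum_(i < d) rcoord l i * (a i + 2^-1)) *
     \prod_(i < d) sinc (rcoord l i))%:E)%E.
Proof.
elim: d l c a => [|d IH] l c a.
  under eq_integral do rewrite /rdot big_ord0.
  have [mc lc] := @cube_measure 0 a.
  by rewrite integral_cst // !big_ord0 mulr1 -[X in (_ * X)%E]/(leb R 0 (cube a)) lc mule1.
have [mc lc] := @cube_measure d.+1 a; have [mc' lc'] := @cube_measure d (fun i => a i.+1).
have fin : (leb R d.+1 (cube a) < +oo)%E by rewrite lc ltry.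
rewrite cubeS in mc lc fin *.
have mi : measurable [set t : R | a 0%N <= t < a 0%N + 1].
  by rewrite unit_itvE.
pose f x := (cos (c + 2 * pi * @rdot R d.+1 l x))%:E.
apply: etrans (@integral_setX R _ _ _ _ lebesgue_measure (leb R d) _ _ f mi mc' _) _.
  apply: (cos_integrable (mu := leb R d.+1) mc fin); apply: measurable_funD => //;
    apply: measurable_funM => //; exact: measurable_rdot.
rewrite /f {f fin}.
under eq_integral => t _.
  rewrite (eq_integral (fun y => (cos ((c + 2 * pi * (l.1 * t)) + 2 * pi * rdot l.2 y))%:E)).
    rewrite IH; over.
  by move=> y _; rewrite /rdot big_ord_recl /= mulrDr addrA.
rewrite /=.
under eq_integral => t _ do rewrite addrAC EFinM muleC.
rewrite integralZl //; last first.
  apply: (cos_integrable (mu := lebesgue_measure)) => //.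
    by apply: le_lt_trans (ltry 1); rewrite [leLHS]lebesgue_measure_unit_itv.
  by apply: measurable_funD => //; apply: measurable_funM => //; apply: measurable_funM.
rewrite integral_cos_itv !big_ord_recl /= mulrDr -EFinM; congr EFin.
rewrite [RHS]mulrA mulrC; congr (cos _ * _ * _); ring.
Qed.

End Cubes.

(** * Completeness of L^2 and Parseval's identity *)

Lemma fast_cauchy (R : realType) (r : nat -> R) s : 0 <= s ->
  (forall k, `|r k.+1 - r k| <= s * 2^-1 ^+ k) ->
  exists l, (r @ \oo --> l) /\ forall m, `|l - r m| <= 2 * s * 2^-1 ^+ m.
Proof.
move=> s0 rs; pose e (k : nat) := 2 * s * 2^-1 ^+ k.
have eS k : s * 2^-1 ^+ k = e k - e k.+1 by rewrite /e exprS; field.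
have e0 k : 0 <= e k by rewrite /e !mulr_ge0 // exprn_ge0.
have ecvg : e @ \oo --> (0 : R).
  rewrite -[0](mulr0 (2 * s)); apply: cvgM; first exact: cvg_cst.
  by apply: cvg_expr; rewrite ger0_norm // invf_lt1 // ltr1n.
have near m j : `|r (m + j)%N - r m| <= e m - e (m + j)%N.
  elim: j => [|j IH]; first by rewrite addn0 !subrr normr0.
  rewrite addnS; have := rs (m + j)%N; rewrite eS => H.
  have -> : r (m + j).+1 - r m = (r (m + j).+1 - r (m + j)%N) + (r (m + j)%N - r m) by ring.
  by apply: le_trans (ler_normD _ _) _; lra.
(* The step bound [e k - e k.+1] makes [r + e] nonincreasing, and [e] tends to 0. *)
have cv : cvgn (r \+ e).
  apply: nonincreasing_is_cvgn.
    apply/nonincreasing_seqP => k /=; have := rs k; rewrite eS.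
    by move=> /ler_normlP[]; lra.
  exists (r 0%N - e 0%N) => _ [k _ <-] /=.
  by have := near 0%N k; rewrite add0n => /ler_normlP[]; have := e0 k; lra.
pose l := limn (r \+ e); have rl : r @ \oo --> l.
  have -> : r = (r \+ e) \- e by apply/funext => k /=; rewrite addrK.
  by rewrite -[l]subr0; apply: cvgB.
exists l; split => // m.
have -> : `|l - r m| = limn (fun k => `|r k - r m|).
  by apply/esym/cvg_lim => //; apply: cvg_norm; apply: cvgB => //; exact: cvg_cst.
apply: limr_le; first by apply/cvg_ex; eexists; apply: cvg_norm; apply: cvgB rl _;
  exact: cvg_cst.
near=> k; have mk : (m <= k)%N by near: k; exact: nbhs_infty_ge.
by have := near m (k - m)%N; rewrite subnKC // => H; have := e0 k; rewrite -/(e m); lra.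
Unshelve. all: by end_near.
Qed.

Section FastLimit.
Context (R : realType) d (T : measurableType d) (mu : {measure set T -> \bar R}).
Variables (D : set T) (mD : measurable D).

(** Riesz-Fischer at a fixed rate: the weight [4 ^+ k] against [16^-1 ^+ k] leaves a summable
    [4^-1 ^+ k], so the sequence itself converges almost everywhere, without extraction. *)
Lemma L2_fast_limit (r : nat -> T -> R) :
  (forall k, measurable_fun setT (r k)) ->
  (forall k, (\int[mu]_(x in D) ((r k.+1 x - r k x) ^+ 2)%:E <= (16^-1 ^+ k)%:E)%E) ->
  exists2 l : T -> R, measurable_fun setT l &
    forall m, (\int[mu]_(x in D) ((l x - r m x) ^+ 2)%:E <= (8 * 4^-1 ^+ m)%:E)%E.
Proof.
move=> mr rd.
pose g k x := (4 ^+ k * (r k.+1 x - r k x) ^+ 2)%:E.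
have mg k : measurable_fun setT (g k).
  apply/measurable_EFinP; apply: measurable_funM => //; apply: measurable_funX.
  exact: measurable_funB.
have g0 k x : (0 <= g k x)%E by rewrite lee_fin mulr_ge0 ?sqr_ge0 // exprn_ge0.
(* [h] is integrable, hence finite almost everywhere, and where it is finite
   [|r k.+1 - r k| <= 2 ^- k * sqrt h]. *)
pose h x := (\sum_(0 <= k <oo) g k x)%E.
have mh : measurable_fun setT h.
  by apply: ge0_emeasurable_sum => // k x _ _; exact: g0.
have h0 x : (0 <= h x)%E by apply: nneseries_ge0 => k _ _; exact: g0.
have inth : (\int[mu]_(x in D) h x <= 2%:E)%E.
  rewrite integral_nneseries //; last by move=> k; exact: measurable_funTS.
  apply: (@le_trans _ _ (\sum_(0 <= k <oo) (4^-1 ^+ k)%:E)%E).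
    apply: lee_nneseries => [k _ _|k _]; first exact: integral_ge0.
    rewrite /g; under eq_integral do rewrite EFinM.
    rewrite ge0_integralZl //; last 2 first.
    - apply: measurable_funTS; apply/measurable_EFinP; apply: measurable_funX;
      exact: measurable_funB.
    - by move=> x _; rewrite lee_fin sqr_ge0.
    apply: le_trans (lee_wpmul2l _ (rd k)) _; first by rewrite lee_fin exprn_ge0.
    by rewrite -EFinM lee_fin -exprMn; rewrite le_eqVlt; apply/orP; left; apply/eqP;
      congr (_ ^+ _); field.
  apply: lime_le.
    by apply: is_cvg_nneseries => k _ _; rewrite lee_fin exprn_ge0.
  apply: nearW => n; rewrite sumEFin lee_fin big_mkord.
  have : \sum_(i < n) (4^-1 : R) ^+ i <= 2 - 2 * 4^-1 ^+ n.
    elim: n => [|n IH]; first by rewrite big_ord0 expr0 mulr1 subrr.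
    by rewrite big_ord_recr /= exprS; have : 0 <= (4^-1 : R) ^+ n by []; lra.
  by move/le_trans; apply; rewrite lerBlDr lerDl mulr_ge0 // exprn_ge0.
pose H := [set x | (h x < +oo)%E].
have mH : measurable H.
  by rewrite -[H]setTI; apply: emeasurable_fun_infty_o.
have gh k x : (g k x <= h x)%E.
  apply: le_trans (nneseries_lim_ge k.+1 (fun n _ _ => g0 n x)).
  by rewrite big_nat_recr //= leeDr // sume_ge0.
have bound x : H x -> exists l, ((fun k => r k x) @ \oo --> l) /\
    forall m, ((((l - r m x) ^+ 2)%:E <= (4 * 4^-1 ^+ m)%:E * h x))%E.
  move=> Hx; have hf : h x \is a fin_num by rewrite ge0_fin_numE.
  pose s := Num.sqrt (fine (h x)).
  have s2 : s ^+ 2 = fine (h x) by rewrite sqr_sqrtr // fine_ge0.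
  have s0 : 0 <= s by exact: sqrtr_ge0.
  have [k|l [rl lm]] := @fast_cauchy R (fun k => r k x) s s0.
    rewrite -(@ler_pXn2r _ 2) ?nnegrE ?mulr_ge0 ?exprn_ge0 //.
    rewrite -normrX ger0_norm ?sqr_ge0 // exprMn s2.
    have := gh k x; rewrite -[h x]fineK // lee_fin mulrC -ler_pdivlMr ?exprn_gt0 //.
    move/le_trans; apply; rewrite le_eqVlt; apply/orP; left; apply/eqP => /=.
    by congr (_ * _); rewrite -exprVn [RHS]exprAC; congr (_ ^+ _); field.
  exists l; split=> // m; rewrite -[h x]fineK // -EFinM lee_fin -s2.
  have : `|l - r m x| ^+ 2 <= (2 * s * 2^-1 ^+ m) ^+ 2.
    by rewrite ler_pXn2r ?nnegrE ?mulr_ge0 ?exprn_ge0.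
  rewrite -normrX ger0_norm ?sqr_ge0 // => /le_trans; apply; rewrite le_eqVlt; apply/orP;
    left; apply/eqP.
  rewrite !exprMn exprAC (_ : 2^-1 ^+ 2 = 4^-1); first by ring.
  by field.
have /choice[l lP] x : exists l, H x -> ((fun k => r k x) @ \oo --> l) /\
    forall m, ((((l - r m x) ^+ 2)%:E <= (4 * 4^-1 ^+ m)%:E * h x))%E.
  by have [/bound[l lP]|nH] := pselect (H x); [exists l | exists 0].
(* The indicator sets the limit to 0 where convergence may fail; there [h] is infinite and the final
   bound is trivial. *)
have ml : measurable_fun setT (fun x => \1_H x * l x).
  apply: (@measurable_fun_cvg _ _ _ _ (fun k x => \1_H x * r k x)) => //.
    by move=> k; apply: measurable_funM => //; exact: measurable_indic.
  move=> x _; have [Hx|nH] := pselect (H x).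
    by apply: cvgM; [exact: cvg_cst|exact: (lP x Hx).1].
  rewrite indicE memNset // mul0r; under eq_fun do rewrite mul0r; exact: cvg_cst.
exists (fun x => \1_H x * l x) => //.
move=> m; apply: (@le_trans _ _ (\int[mu]_(x in D) ((4 * 4^-1 ^+ m)%:E * h x))%E).
  apply: ge0_le_integral => //.
  - by move=> x _; rewrite lee_fin sqr_ge0.
  - apply: measurable_funTS; apply/measurable_EFinP; apply: measurable_funX;
    exact: measurable_funB.
  - by apply/measurable_funTS; apply: measurable_funeM.
  move=> x _; have [Hx|nH] := pselect (H x).
    by rewrite indicE mem_set // mul1r; exact: (lP x Hx).2.
  have -> : h x = +oo%E by apply/eqP; rewrite -leye_eq leNgt; apply/negP.
  by rewrite gt0_muley ?leey // lte_fin mulr_gt0 // exprn_gt0.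
rewrite ge0_integralZl //; last exact: measurable_funTS.
apply: le_trans (lee_wpmul2l _ inth) _; first by rewrite lee_fin mulr_ge0 // exprn_ge0.
by rewrite -EFinM lee_fin; rewrite le_eqVlt; apply/orP; left; apply/eqP; ring.
Qed.

End FastLimit.

(** * Orthogonal residuals, algebraically *)

Section Residual.
Variables (R : realFieldType) (V : lmodType R) (P : V -> Prop) (ip : V -> V -> R).
Hypothesis P_lin : forall a x y, P x -> P y -> P (a *: x + y).
Hypothesis ipC : forall x y, ip x y = ip y x.
Hypothesis ip_lin : forall a x y z, P x -> P y -> P z ->
  ip (a *: x + y) z = a * ip x z + ip y z.
Variables (I : eqType) (L : I -> Prop) (g : I -> V) (w : R).
Hypothesis w0 : 0 < w.
Hypothesis Pg : forall i, P (g i).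
Hypothesis g_orth : forall i j, L i -> L j -> i != j -> ip (g i) (g j) = 0.
Hypothesis g_norm : forall i, L i -> ip (g i) (g i) = w.

(** For distinct indices in [L], this is [f] minus its projection on the span of the [g i]. The
    predicate [P] restricts linearity of [ip] to a class of vectors, as integrals require. *)
Definition residual (f : V) (s : seq I) : V :=
  foldr (fun i r => - (ip f (g i) / w) *: g i + r) f s.

Variable f : V.
Hypothesis Pf : P f.

Lemma residual_P s : P (residual f s).
Proof. by elim: s => //= i s IH; exact: P_lin. Qed.

Lemma residual_ip s j : uniq s -> (forall i, i \in s -> L i) -> L j ->
  ip (residual f s) (g j) = if j \in s then 0 else ip f (g j).
Proof.
move=> + + Lj; elim: s => //= i s IH /andP[Ns us] sL.
have Li : L i by apply: sL; rewrite inE eqxx.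
have {}IH := IH us (fun k ks => sL k (mem_behead (s := i :: s) ks)).
rewrite ip_lin //; last exact: residual_P.
rewrite IH inE; case: eqVneq => [->|ji] /=.
  by rewrite (negPf Ns) g_norm // mulNr divfK ?gt_eqF // addNr.
by rewrite g_orth 1?eq_sym // mulr0 add0r.
Qed.

Lemma residual_ip_sub s s' : uniq s -> (forall i, i \in s -> L i) ->
  {subset s' <= s} -> ip (residual f s) (residual f s') = ip (residual f s) f.
Proof.
move=> us sL; elim: s' => //= i s' IH sub.
rewrite ipC ip_lin //; try exact: residual_P.
rewrite ![ip _ (residual f s)]ipC IH; last first.
  by move=> k ks; apply: sub; rewrite inE ks orbT.
rewrite residual_ip //; last by apply/sL/sub; rewrite inE eqxx.
by rewrite sub ?inE ?eqxx // mulr0 add0r.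
Qed.

Lemma ip_residual_cons s i : uniq (i :: s) -> (forall j, j \in i :: s -> L j) ->
  ip (residual f (i :: s)) (residual f (i :: s)) =
  ip (residual f s) (residual f s) - (ip f (g i)) ^+ 2 / w.
Proof.
move=> /= /andP[Ns us] sL; have Li : L i by apply: sL; rewrite inE eqxx.
have PR := residual_P s.
have ri : ip (residual f s) (g i) = ip f (g i).
  rewrite residual_ip ?(negPf Ns) // => k ks; apply: sL; rewrite inE ks orbT //.
rewrite ip_lin //; last exact: P_lin.
rewrite ![ip _ (- _ *: _ + _)]ipC !ip_lin // g_norm // [ip (g i) _]ipC ri.
by field; rewrite gt_eqF.
Qed.

Lemma ip_residual s : uniq s -> (forall j, j \in s -> L j) ->
  ip (residual f s) (residual f s) = ip f f - (\sum_(i <- s) (ip f (g i)) ^+ 2) / w.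
Proof.
elim: s => [|i s IH] us sL; first by rewrite big_nil mul0r subr0.
have us' : uniq s by case/andP: us.
have s'L j : j \in s -> L j by move=> js; apply: sL; rewrite inE js orbT.
by rewrite ip_residual_cons // IH // big_cons; ring.
Qed.

(** Pythagoras: the larger family's residual is orthogonal to the difference. Nested families that
    minimize the residual norm thus have Cauchy residuals. *)
Lemma ip_residualB s s' : uniq s -> uniq s' -> (forall j, j \in s -> L j) ->
  {subset s' <= s} ->
  ip (residual f s - residual f s') (residual f s - residual f s') =
  ip (residual f s') (residual f s') - ip (residual f s) (residual f s).
Proof.
move=> us us' sL sub; have PR := residual_P.
have s'L j : j \in s' -> L j by move/sub/sL.
have -> : residual f s - residual f s' = (-1) *: residual f s' + residual f s.
  by rewrite scaleN1r addrC.
rewrite ip_lin //; last exact: P_lin.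
rewrite ![ip _ (-1 *: _ + _)]ipC !ip_lin //.
rewrite [ip (residual f s') (residual f s)]ipC !residual_ip_sub //; ring.
Qed.

End Residual.

Lemma exists_expr_lt (R : realType) (K q delta : R) : 0 <= q -> q < 1 -> 0 < delta ->
  exists m, K * q ^+ m < delta.
Proof.
move=> q0 q1 delta0.
have : (fun m => K * q ^+ m) @ \oo --> (0 : R).
  rewrite -[0](mulr0 K); apply: cvgM; first exact: cvg_cst.
  by apply: cvg_expr; rewrite ger0_norm.
move=> /cvgr0Pnorm_lt/(_ _ delta0)[m _ /(_ m (leqnn m))] /=.
by move/(le_lt_trans (ler_norm _)) => lt; exists m.
Qed.

(** * Bessel's inequality and approximate Parseval in L^2 *)

Section L2Pairs.
Context (R : realType) d (T : measurableType d) (mu : {measure set T -> \bar R}).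
Variables (D : set T) (mD : measurable D) (finD : (mu D < +oo)%E).

Definition bounded_mfun (u : T -> R) :=
  measurable_fun setT u /\ exists M, forall x, `|u x| <= M.

(** Complex functions as pairs of real ones. On a domain of finite measure, boundedness makes all
    products integrable; L^2 limits may leave this class. *)
Definition bounded_pair (F : T -> R^o * R^o) :=
  bounded_mfun (fun x => (F x).1) /\ bounded_mfun (fun x => (F x).2).

Definition ptdot (F G : T -> R^o * R^o) (x : T) : R := (F x).1 * (G x).1 + (F x).2 * (G x).2.

Definition ip (F G : T -> R^o * R^o) : R := Rintegral mu D (ptdot F G).

Lemma bounded_mfun_integrable u : bounded_mfun u -> mu.-integrable D (EFin \o u).
Proof.
move=> [mu_ [M uM]]; apply: measurable_bounded_integrable => //; first exact: measurable_funTS.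
by exists M; split; [exact: num_real|move=> N MN x _; exact: le_trans (uM x) (ltW MN)].
Qed.

Lemma bounded_mfunD u v : bounded_mfun u -> bounded_mfun v -> bounded_mfun (fun x =>
  u x + v x).
Proof.
move=> [mu_ [M uM]] [mv [N vN]]; split; first exact: measurable_funD.
by exists (M + N) => x; apply: le_trans (ler_normD _ _) _; exact: lerD.
Qed.

Lemma bounded_mfunM u v : bounded_mfun u -> bounded_mfun v -> bounded_mfun (fun x =>
  u x * v x).
Proof.
move=> [mu_ [M uM]] [mv [N vN]]; split; first exact: measurable_funM.
by exists (M * N) => x; rewrite normrM; exact: ler_pM.
Qed.

Lemma bounded_mfun_cst a : bounded_mfun (fun=> a).
Proof. by split; [exact: measurable_cst | exists `|a|]. Qed.

Lemma bounded_pair_lin a F G : bounded_pair F -> bounded_pair G -> bounded_pair (a *: F + G).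
Proof.
move=> [F1 F2] [G1 G2]; split.
  exact: (bounded_mfunD (bounded_mfunM (bounded_mfun_cst a) F1) G1).
exact: (bounded_mfunD (bounded_mfunM (bounded_mfun_cst a) F2) G2).
Qed.

Lemma bounded_ptdot F G : bounded_pair F -> bounded_pair G -> bounded_mfun (ptdot F G).
Proof. by move=> [F1 F2] [G1 G2]; apply: bounded_mfunD; exact: bounded_mfunM. Qed.

Lemma ipE F G : bounded_pair F -> bounded_pair G ->
  (\int[mu]_(x in D) (ptdot F G x)%:E = (ip F G)%:E)%E.
Proof.
move=> PF PG; rewrite /ip /Rintegral fineK //.
exact/integrable_fin_num/bounded_mfun_integrable/bounded_ptdot.
Qed.

Lemma ipC F G : ip F G = ip G F.
Proof. by apply: eq_Rintegral => x _; rewrite /ptdot mulrC [X in _ + X]mulrC. Qed.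

Lemma ip_lin a F G H : bounded_pair F -> bounded_pair G -> bounded_pair H ->
  ip (a *: F + G) H = a * ip F H + ip G H.
Proof.
move=> PF PG PH; have i1 := bounded_mfun_integrable (bounded_ptdot PF PH).
have i2 := bounded_mfun_integrable (bounded_ptdot PG PH).
rewrite /ip -RintegralZl // -RintegralD //; last first.
  exact: (bounded_mfun_integrable (bounded_mfunM (bounded_mfun_cst a) (bounded_ptdot PF PH))).
apply: eq_Rintegral => x _; rewrite /ptdot.
rewrite -[((a *: F + G) x).1]/(a * (F x).1 + (G x).1).
rewrite -[((a *: F + G) x).2]/(a * (F x).2 + (G x).2); ring.
Qed.

Lemma ip_ge0 F : 0 <= ip F F.
Proof.
apply: Rintegral_ge0 => x _; rewrite /ptdot -!expr2; apply: addr_ge0; exact: sqr_ge0.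
Qed.

Variables (I : eqType) (L : set I) (g : I -> T -> R^o * R^o) (w : R).
Hypothesis w0 : 0 < w.
Hypothesis Pg : forall i, bounded_pair (g i).
Hypothesis g_orth : forall i j, L i -> L j -> i != j -> ip (g i) (g j) = 0.
Hypothesis g_norm : forall i, L i -> ip (g i) (g i) = w.

Lemma bessel f s : bounded_pair f -> uniq s -> (forall i, i \in s -> L i) ->
  \sum_(i <- s) (ip f (g i)) ^+ 2 <= w * ip f f.
Proof.
move=> Pf us sL; rewrite mulrC -ler_pdivrMr // -subr_ge0.
by rewrite -(ip_residual bounded_pair_lin ipC ip_lin w0 Pg g_orth g_norm Pf us sL) ip_ge0.
Qed.

Hypothesis g_complete : forall u v : T -> R, measurable_fun setT u -> measurable_fun setT v ->
  (\int[mu]_(x in D) ((u x) ^+ 2 + (v x) ^+ 2)%:E < +oo)%E ->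
  (forall i, L i -> \int[mu]_(x in D) (u x * (g i x).1 + v x * (g i x).2)%:E = 0)%E ->
  (\int[mu]_(x in D) ((u x) ^+ 2 + (v x) ^+ 2)%:E = 0)%E.

Variable f : T -> R^o * R^o.
Hypothesis Pf : bounded_pair f.

Local Notation res s := (residual ip g w f s).
Local Notation E s := (ip (res s) (res s)).
Let adm (s : seq I) := uniq s /\ forall i, i \in s -> L i.

Let PR s : bounded_pair (res s).
Proof. exact: (residual_P ip bounded_pair_lin w Pg Pf). Qed.

Let residualB s s' : adm s -> adm s' -> {subset s' <= s} ->
  ip (res s - res s') (res s - res s') = E s' - E s.
Proof.
move=> [us sL] [us' _]; exact: (ip_residualB bounded_pair_lin ipC ip_lin w0 Pg g_orth g_norm).
Qed.

Let E_mono s s' : adm s -> adm s' -> {subset s' <= s} -> E s <= E s'.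
Proof. by move=> as_ as' sub; rewrite -subr_ge0 -residualB // ip_ge0. Qed.

Let minimizing : exists (s : nat -> seq I) (e0 : R),
  [/\ forall k, adm (s k), forall k, {subset s k <= s k.+1},
      forall t, adm t -> e0 <= E t & forall k, E (s k) < e0 + 16^-1 ^+ k].
Proof.
pose X := [set E t | t in adm].
have lbX : has_inf X.
  split; first by exists (E [::]), [::].
  by exists 0 => _ [t _ <-]; exact: ip_ge0.
have /choice[t tP] k : exists t, adm t /\ E t < inf X + 16^-1 ^+ k.
  have [|_ [t at_ <-] tlt] := @inf_adherent _ X (16^-1 ^+ k) _ lbX.
    by rewrite exprn_gt0.
  by exists t.
(* Near-minimizers are accumulated to make the families nested; enlarging a family never increases
   the residual norm, so the rate survives. *)
pose fix s k := if k is k'.+1 then undup (t k ++ s k') else t 0%N.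
have adms k : adm (s k).
  elim: k => [|k [_ IH]] /=; first by have [] := tP 0%N.
  split; first exact: undup_uniq.
  move=> i; rewrite mem_undup mem_cat => /orP[|/IH //].
  by have [[_ +] _] := tP k.+1; apply.
have inX u : adm u -> inf X <= E u by move=> au; apply: ge_inf; [exact: lbX.2|exists u].
exists s, (inf X); split=> // [k i ik|k].
  by rewrite /= mem_undup mem_cat ik orbT.
apply: le_lt_trans (tP k).2; apply: E_mono => //; first exact: (tP k).1.
by case: k => [|k] i it //=; rewrite mem_undup mem_cat it.
Qed.

(* The residuals along a minimizing sequence of finite families converge in L^2 to
   a function orthogonal to all [g i], which vanishes by completeness. *)
Lemma complete_residual delta : 0 < delta ->
  exists s, [/\ uniq s, forall i, i \in s -> L i & E s < delta].
Proof.
move=> delta0; have [s [e0 [adms subs e0le sE]]] := minimizing.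
pose U k x : R := (res (s k) x).1; pose W k x : R := (res (s k) x).2.
have mU k : measurable_fun setT (U k) by case: (PR (s k)) => -[].
have mW k : measurable_fun setT (W k) by case: (PR (s k)) => _ [].
have step k : (\int[mu]_(x in D) ((U k.+1 x - U k x) ^+ 2 + (W k.+1 x - W k x) ^+ 2)%:E
    <= (16^-1 ^+ k)%:E)%E.
  have -> : (\int[mu]_(x in D) ((U k.+1 x - U k x) ^+ 2 + (W k.+1 x - W k x) ^+ 2)%:E =
     (ip (res (s k.+1) - res (s k)) (res (s k.+1) - res (s k)))%:E)%E.
    have PB : bounded_pair (res (s k.+1) - res (s k)).
      by rewrite addrC -scaleN1r; exact: bounded_pair_lin.
    by rewrite -ipE //; apply: eq_integral => x _; rewrite /ptdot /U /W !expr2.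
  rewrite residualB //.
  by rewrite lee_fin; have := sE k; have := e0le _ (adms k.+1); lra.
have [||u mu_ uU] := @L2_fast_limit _ _ _ mu D mD U; first exact: mU.
  move=> k; apply: le_trans (step k); apply: ge0_le_integral => //.
  - by move=> x _; rewrite lee_fin sqr_ge0.
  - apply: measurable_funTS; apply/measurable_EFinP; apply: measurable_funX;
    exact: measurable_funB.
  - apply: measurable_funTS; apply/measurable_EFinP.
    by apply: measurable_funD; apply: measurable_funX; exact: measurable_funB.
  - by move=> x _; rewrite lee_fin lerDl sqr_ge0.
have [||v mv vW] := @L2_fast_limit _ _ _ mu D mD W; first exact: mW.
  move=> k; apply: le_trans (step k); apply: ge0_le_integral => //.
  - by move=> x _; rewrite lee_fin sqr_ge0.
  - apply: measurable_funTS; apply/measurable_EFinP; apply: measurable_funX;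
    exact: measurable_funB.
  - apply: measurable_funTS; apply/measurable_EFinP.
    by apply: measurable_funD; apply: measurable_funX; exact: measurable_funB.
  - by move=> x _; rewrite lee_fin lerDr sqr_ge0.
pose err m x := (u x - U m x) ^+ 2 + (v x - W m x) ^+ 2.
have merr m : measurable_fun setT (err m).
  by apply: measurable_funD; apply: measurable_funX; exact: measurable_funB.
have err0 m x : 0 <= err m x by rewrite addr_ge0 // sqr_ge0.
have interr m : (\int[mu]_(x in D) (err m x)%:E <= (16 * 4^-1 ^+ m)%:E)%E.
  under eq_integral do rewrite EFinD.
  rewrite ge0_integralD //; last 4 first.
  - by move=> x _; rewrite lee_fin sqr_ge0.
  - apply: measurable_funTS; apply/measurable_EFinP; apply: measurable_funX;
    exact: measurable_funB.
  - by move=> x _; rewrite lee_fin sqr_ge0.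
  - apply: measurable_funTS; apply/measurable_EFinP; apply: measurable_funX;
    exact: measurable_funB.
  apply: le_trans (leeD (uU m) (vW m)) _; rewrite -EFinD lee_fin; lra.
have msq : measurable_fun setT (fun x => u x ^+ 2 + v x ^+ 2).
  by apply: measurable_funD; apply: measurable_funX.
have mdotmm m : measurable_fun setT (ptdot (res (s m)) (res (s m))).
  by case: (bounded_ptdot (PR (s m)) (PR (s m))).
have sq_bound m (a b : T -> R) : measurable_fun setT a -> measurable_fun setT b ->
    (forall x, 0 <= a x) -> (forall x, 0 <= b x) -> (forall x, a x <= 2 * (b x + err m x)) ->
    (\int[mu]_(x in D) (a x)%:E <= 2%:E * (\int[mu]_(x in D) (b x)%:E + (16 * 4^-1 ^+
      m)%:E))%E.
  move=> ma mb a0 b0 ab.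
  apply: (@le_trans _ _ (\int[mu]_(x in D) (2%:E * ((b x)%:E + (err m x)%:E)))%E).
    apply: ge0_le_integral => //.
    - by move=> x _; rewrite lee_fin.
    - by apply: measurable_funTS; apply/measurable_EFinP.
    - apply: measurable_funTS; apply: measurable_funeM; apply: emeasurable_funD;
      exact/measurable_EFinP.
    - by move=> x _; rewrite -EFinD -EFinM lee_fin.
  rewrite ge0_integralZl //; last 2 first.
  - by apply: measurable_funTS; apply: emeasurable_funD; exact/measurable_EFinP.
  - by move=> x _; rewrite adde_ge0 // lee_fin.
  apply: lee_wpmul2l => //; rewrite ge0_integralD //; last 4 first.
  - by move=> x _; rewrite lee_fin.
  - by apply: measurable_funTS; exact/measurable_EFinP.
  - by move=> x _; rewrite lee_fin.
  - by apply: measurable_funTS; exact/measurable_EFinP.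
  exact: leeD.
have L2uv : (\int[mu]_(x in D) (u x ^+ 2 + v x ^+ 2)%:E < +oo)%E.
  apply: le_lt_trans (sq_bound 0%N _ _ msq (mdotmm 0%N) _ _ _) _.
  - by move=> x; rewrite addr_ge0 // sqr_ge0.
  - by move=> x; rewrite /ptdot -!expr2 addr_ge0 // sqr_ge0.
  - move=> x; rewrite /ptdot /err -/(U 0%N x) -/(W 0%N x) -subr_ge0.
    set p := U 0%N x; set q := W 0%N x.
    rewrite [leRHS](_ : _ = (2 * p - u x) ^+ 2 + (2 * q - v x) ^+ 2); last by ring.
    by rewrite addr_ge0 // sqr_ge0.
  by rewrite ipE // -EFinD -EFinM ltry.
have orth i : L i -> (\int[mu]_(x in D) (u x * (g i x).1 + v x * (g i x).2)%:E = 0)%E.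
  move=> Li; have [[mg1 [M1 gM1]] [mg2 [M2 gM2]]] := Pg i.
  pose M := `|M1| + `|M2|; have M0 : 0 <= M by rewrite addr_ge0.
  have gM x : `|(g i x).1| <= M /\ `|(g i x).2| <= M.
    have := gM1 x; have := gM2 x; have := ler_norm M1; have := ler_norm M2; rewrite /M.
    have := normr_ge0 M1; have := normr_ge0 M2; lra.
  pose B m x := ptdot (res (s m)) (g i) x.
  pose C m x := (u x - U m x) * (g i x).1 + (v x - W m x) * (g i x).2.
  have mC m : measurable_fun setT (C m).
    by apply: measurable_funD; apply: measurable_funM => //; exact: measurable_funB.
  pose q m : R := 2^-1 ^+ m.
  have q0 m : 0 < q m by rewrite exprn_gt0.
  have absC m x : `|C m x| <= M * (2 * q m + (q m)^-1 * err m x).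
    (* Used in place of Cauchy-Schwarz: with [q m = 2^-1 ^+ m] and [err m] of integral at most
       [16 * 4^-1 ^+ m], both terms integrate to a multiple of [q m]. *)
    have young (a : R) : `|a| <= q m + (q m)^-1 * a ^+ 2.
      have qn := q0 m; rewrite -(ler_pM2l qn) mulrDr mulrA divff ?gt_eqF // mul1r.
      rewrite -[a ^+ 2]ger0_norm ?sqr_ge0 // normrX.
      by have := normr_ge0 a; nra.
    apply: le_trans (ler_normD _ _) _; rewrite !normrM.
    have [H1 H2] := gM x; have Y1 := young (u x - U m x); have Y2 := young (v x - W m x).
    apply: (@le_trans _ _ (`|u x - U m x| * M + `|v x - W m x| * M)).
      by apply: lerD; apply: ler_wpM2l.
    rewrite -mulrDl mulrC ler_wpM2l // /err; lra.
  have muDf : mu D = (fine (mu D))%:E by rewrite fineK // ge0_fin_numE.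
  have intC m : (\int[mu]_(x in D) `|(C m x)%:E| <= (M * (2 * fine (mu D) + 16) * q m)%:E)%E.
    have qV0 : 0 <= (q m)^-1 by rewrite invr_ge0 ltW.
    have mE : measurable_fun D (fun x => (err m x)%:E).
      by apply: measurable_funTS; exact/measurable_EFinP.
    apply: (@le_trans _ _ (\int[mu]_(x in D) (M%:E * ((2 * q m)%:E + (q m)^-1%:E * (err m
      x)%:E)))%E).
      apply: ge0_le_integral => //.
      - by apply: measurableT_comp => //; apply: measurable_funTS; exact/measurable_EFinP.
      - apply: measurable_funeM; apply: emeasurable_funD => //; exact: measurable_funeM.
      - by move=> x _; rewrite -[leRHS]/((M * (2 * q m + (q m)^-1 * err m x))%:E) lee_fin.
    rewrite ge0_integralZl //; last 2 first.
    - by apply: emeasurable_funD => //; exact: measurable_funeM.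
    - move=> x _; rewrite adde_ge0 ?mule_ge0 // lee_fin ?mulr_ge0 // ltW //.
    rewrite ge0_integralD //; last 3 first.
    - by move=> x _; rewrite lee_fin mulr_ge0 // ltW.
    - by move=> x _; rewrite mule_ge0 // lee_fin.
    - exact: measurable_funeM.
    rewrite integral_cst // ge0_integralZl //; last by move=> x _; rewrite lee_fin.
    rewrite muDf -EFinM; apply: (@le_trans _ _
      (M%:E * ((2 * q m * fine (mu D))%:E + (q m)^-1%:E * (16 * 4^-1 ^+ m)%:E))%E).
      apply: lee_wpmul2l; first by rewrite lee_fin.
      by apply: leeD => //; apply: lee_wpmul2l.
    rewrite -[leLHS]/((M * (2 * q m * fine (mu D) + (q m)^-1 * (16 * 4^-1 ^+ m)))%:E) lee_fin.
    have -> : 4^-1 ^+ m = q m * q m :> R.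
      by rewrite /q -exprMn; congr (_ ^+ _); field.
    rewrite le_eqVlt; apply/orP; left; apply/eqP; field.
    by rewrite gt_eqF.
  have iB m : mu.-integrable D (EFin \o B m).
    exact/bounded_mfun_integrable/bounded_ptdot.
  have iC m : mu.-integrable D (EFin \o C m).
    apply/integrableP; split; first by apply: measurable_funTS; exact/measurable_EFinP.
    exact: le_lt_trans (intC m) (ltry _).
  pose A x := u x * (g i x).1 + v x * (g i x).2.
  have AE m : (\int[mu]_(x in D) (A x)%:E = (ip (res (s m)) (g i))%:E + \int[mu]_(x in D) (C
    m x)%:E)%E.
    rewrite -ipE //; apply: etrans _ (integralD mD (iB m) (iC m)); apply: eq_integral =>
      x _ /=.
    by rewrite -EFinD /A /B /C /ptdot -/(U m x) -/(W m x); congr EFin; ring.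
  have ipb m : `|ip (res (s m)) (g i)| <= (1 + w) * q m.
    have [us sL] := adms m.
    rewrite (residual_ip bounded_pair_lin ip_lin w0 Pg g_orth g_norm Pf us sL Li).
    case: ifPn => [_|nis]; first by rewrite normr0 mulr_ge0 ?ltW ?addr_gt0.
    (* Adding [i] lowers the squared residual norm by [c ^+ 2 / w], yet not below [e0]; so [c ^+ 2]
       is at most [w * 16^-1 ^+ m]. The factor [1 + w] then dominates the square root of [w]. *)
    have adm' : adm (i :: s m).
      split; first by rewrite /= nis.
      by move=> k; rewrite inE => /predU1P[->|/sL].
    have := e0le _ adm'.
    rewrite (ip_residual_cons bounded_pair_lin ipC ip_lin w0 Pg g_orth g_norm Pf adm'.1
      adm'.2).
    have qq : (16^-1 : R) ^+ m <= q m * q m.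
      rewrite /q -exprMn; apply: lerXn2r; rewrite ?nnegrE; lra.
    have := sE m; set c := ip f (g i) => lt1 lt2.
    have : c ^+ 2 <= w * (q m * q m).
      by rewrite mulrC -ler_pdivrMr //; lra.
    rewrite -[c ^+ 2]ger0_norm ?sqr_ge0 // normrX => c2.
    rewrite -(@ler_pXn2r _ 2) ?nnegrE ?mulr_ge0 ?(ltW (q0 m)) ?addr_ge0 ?(ltW w0) //.
    by apply: le_trans c2 _; rewrite exprMn !expr2; have := q0 m; nra.
  have bnd m : (`|\int[mu]_(x in D) (A x)%:E| <= ((M * (2 * fine (mu D) + 16) + (1 + w)) * q
    m)%:E)%E.
    rewrite (AE m); apply: le_trans (lee_abs_add _ _) _. rewrite mulrDl EFinD addeC.
    apply: leeD; last by rewrite abse_EFin lee_fin.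
    by apply: le_trans (le_abse_integral _ _ _) (intC m) => //;
      exact: (measurable_int _ (iC m)).
  apply/eqP; rewrite -abse_eq0 eq_le abse_ge0 andbT; apply/lee_addgt0Pr => eps eps0.
  have [m mlt] := @exists_expr_lt _ (M * (2 * fine (mu D) + 16) + (1 + w)) 2^-1 eps
     ltac:(lra) ltac:(lra) eps0.
  by rewrite add0e; apply: le_trans (bnd m) _; rewrite lee_fin ltW.
have z0 := g_complete mu_ mv L2uv orth.
have Em m : E (s m) <= 32 * 4^-1 ^+ m.
  rewrite -lee_fin -ipE //; apply: le_trans (sq_bound m _ _ (mdotmm m) msq _ _ _) _.
  - by move=> x; rewrite /ptdot -!expr2 addr_ge0 // sqr_ge0.
  - by move=> x; rewrite addr_ge0 // sqr_ge0.
  - move=> x; rewrite /ptdot /err -/(U m x) -/(W m x) -subr_ge0.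
    rewrite [leRHS](_ : _ = (2 * u x - U m x) ^+ 2 + (2 * v x - W m x) ^+ 2); last by ring.
    by rewrite addr_ge0 // sqr_ge0.
  by rewrite z0 add0e -EFinM lee_fin; lra.
have [m mlt] : exists m, 32 * (4^-1 : R) ^+ m < delta by apply: exists_expr_lt => //; lra.
by exists (s m); have [? ?] := adms m; split=> //; exact: le_lt_trans (Em m) mlt.
Qed.

End L2Pairs.

Lemma ler_sum_sub (R : numDomainType) (I : eqType) (s s' : seq I) (F : I -> R) :
  uniq s -> uniq s' -> (forall i, 0 <= F i) -> {subset s <= s'} ->
  \sum_(i <- s) F i <= \sum_(i <- s') F i.
Proof.
move=> us us' F0 sub; rewrite [leRHS](bigID (mem s)) /=.
have -> : \sum_(i <- s) F i = \sum_(i <- s' | i \in s) F i.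
  rewrite -[RHS]big_filter; apply: perm_big; apply: uniq_perm; rewrite ?filter_uniq // => i.
  by rewrite mem_filter; case: (boolP (i \in s)) => // /sub ->.
by rewrite lerDl sumr_ge0.
Qed.

(** * Exponentials as a real orthogonal system *)

Section ExponentialSystem.
Variables (R : realType) (d : nat).
Implicit Types (l m xi x : Rd R d) (a : nat -> R).

Lemma rdot_rsub l m x : rdot (rsub l m) x = rdot l x - rdot m x.
Proof.
by rewrite /rdot -sumrB; apply: eq_bigr => i _; rewrite rcoord_rsub mulrBl.
Qed.

(* [expo (l, false)] and [expo (l, true)] are [e_l] and [i e_l]: over the reals, both
   are needed to span the complex line of [e_l]. *)
Definition expo (lb : Rd R d * bool) x : R^o * R^o :=
  let t := 2 * pi * rdot lb.1 x in if lb.2 then (- sin t, cos t) else (cos t, sin t).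

Definition expo_cube xi a x : R^o * R^o :=
  (\1_(cube a) x * cos (2 * pi * rdot xi x), \1_(cube a) x * sin (2 * pi * rdot xi x)).

Let mt l : measurable_fun setT (fun x => 2 * pi * rdot l x).
Proof. by apply: measurable_funM => //; exact: measurable_rdot. Qed.

Lemma bounded_cos l : bounded_mfun (fun x => cos (2 * pi * rdot l x)).
Proof.
split; last by exists 1 => x; exact: cos_max.
by apply: measurableT_comp (mt l); exact: (continuous_measurable_fun (@continuous_cos R)).
Qed.

Lemma bounded_sin l : bounded_mfun (fun x => sin (2 * pi * rdot l x)).
Proof.
split; last by exists 1 => x; exact: sin_max.
by apply: measurableT_comp (mt l); exact: (continuous_measurable_fun (@continuous_sin R)).
Qed.

Lemma bounded_expo lb : bounded_pair (expo lb).
Proof.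
case: lb => l [] /=; last by split; [exact: bounded_cos|exact: bounded_sin].
split; last exact: bounded_cos.
have [m1 [M sM]] := bounded_sin l; split; first exact: measurableT_comp m1.
by exists M => x; rewrite normrN.
Qed.

Lemma bounded_expo_cube xi a : bounded_pair (expo_cube xi a).
Proof.
have mi : bounded_mfun (\1_(cube a) : Rd R d -> R).
  split; first by apply: measurable_indic; exact: (@cube_measure R d a).1.
  by exists 1 => x; rewrite indicE; case: (_ \in _); rewrite ?normr1 ?normr0.
by split; apply: bounded_mfunM mi _; [exact: bounded_cos|exact: bounded_sin].
Qed.

Variables (D : set (Rd R d)) (w : R) (L : set (Rd R d)).
Hypotheses (mD : measurable D) (Dw : leb R d D = w%:E) (w0 : 0 < w).
Hypothesis orth : forall l m, L l -> L m -> l <> m ->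
  (\int[leb R d]_(x in D) (cos (2 * pi * rdot (rsub l m) x))%:E = 0)%E /\
  (\int[leb R d]_(x in D) (sin (2 * pi * rdot (rsub l m) x))%:E = 0)%E.

Let finD : (leb R d D < +oo)%E. Proof. by rewrite Dw ltry. Qed.

Local Notation dot := (ip (leb R d) D).
Let LL : set (Rd R d * bool) := [set lb | L lb.1].

Lemma ptdot_expo l b m b' x : ptdot (expo (l, b)) (expo (m, b')) x =
  if b == b' then cos (2 * pi * rdot (rsub l m) x)
  else if b then - sin (2 * pi * rdot (rsub l m) x) else sin (2 * pi * rdot (rsub l m) x).
Proof.
rewrite rdot_rsub mulrBr cosB sinB /ptdot /expo /=; case: b; case: b' => /=; ring.
Qed.

Lemma expo_orth i j : LL i -> LL j -> i != j -> dot (expo i) (expo j) = 0.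
Proof.
move: i j => [l b] [m b'] Ll' Lm' ne; have Ll : L l := Ll'; have Lm : L m := Lm'.
have {Ll' Lm'} [lm|lm] := pselect (l = m).
  subst m; have bb : (b == b') = false by apply/negP => /eqP e; rewrite e eqxx in ne.
  rewrite /ip /Rintegral integral0_eq //= => x _; rewrite ptdot_expo bb.
  by rewrite rdot_rsub subrr mulr0 sin0 oppr0 if_same.
have [c0 s0] := orth Ll Lm lm; rewrite /ip /Rintegral.
under eq_integral do rewrite ptdot_expo.
case: (b == b'); first by rewrite c0.
clear ne; case: b; last by rewrite s0.
rewrite (eq_integral (fun x => ((-1) * sin (2 * pi * rdot (rsub l m) x))%:E)) => [|x _].
  under eq_integral do rewrite EFinM.
  rewrite integralZl // ?s0 ?mule0 //.
  exact: (bounded_mfun_integrable mD finD (bounded_sin _)).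
by rewrite mulN1r.
Qed.

Lemma expo_norm i : LL i -> dot (expo i) (expo i) = w.
Proof.
move: i => [l b] _; rewrite /ip /Rintegral.
under eq_integral do rewrite ptdot_expo eqxx rdot_rsub subrr mulr0 cos0.
by rewrite integral_cst // mul1e; exact: (congr1 fine Dw).
Qed.

Section TestFunction.
Variables (xi : Rd R d) (a : nat -> R).
Hypothesis aD : cube a `<=` D.
Let f := expo_cube xi a.

Let integral_cube_ind (h : Rd R d -> R) :
  (\int[leb R d]_(x in D) (\1_(cube a) x * h x)%:E = \int[leb R d]_(x in cube a) (h x)%:E)%E.
Proof.
rewrite -[in RHS](setIidr aD) integral_mkcondr; apply: eq_integral => x _.
by rewrite patchE indicE; case: (x \in cube a); rewrite ?mul1r ?mul0r.
Qed.

Lemma ip_expo_cube : dot f f = 1.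
Proof.
rewrite /ip /Rintegral.
rewrite (eq_integral (fun x => (\1_(cube a) x * 1)%:E)) => [|x _].
  rewrite integral_cube_ind integral_cst; last exact: (@cube_measure R d a).1.
  by rewrite mul1e; exact: (congr1 fine (@cube_measure R d a).2).
have E (b c s : R) : b * b = b -> c ^+ 2 + s ^+ 2 = 1 -> b * c * (b * c) + b * s * (b * s) =
  b * 1.
  by move=> bb <-; rewrite -[in RHS]bb; ring.
congr EFin; apply: E (cos2Dsin2 _); rewrite indicE.
by case: (_ \in _); rewrite ?mulr1 ?mulr0.
Qed.

(** The two products are the real and imaginary parts of the complex coefficient; the phase [th] of
    the cube's centre disappears from its squared modulus. *)
Lemma ip_expo_cube_expo l :
  (dot f (expo (l, false))) ^+ 2 + (dot f (expo (l, true))) ^+ 2 =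
  \prod_(i < d) sinc (rcoord xi i - rcoord l i) ^+ 2.
Proof.
pose th := 2 * pi * \sum_(i < d) rcoord (rsub xi l) i * (a i + 2^-1).
pose P := \prod_(i < d) sinc (rcoord xi i - rcoord l i).
have PE : \prod_(i < d) sinc (rcoord (rsub xi l) i) = P.
  by apply: eq_bigr => i _; rewrite rcoord_rsub.
have -> : dot f (expo (l, false)) = cos th * P.
  rewrite /ip /Rintegral.
  rewrite (eq_integral (fun x => (\1_(cube a) x * cos (0 + 2 * pi * rdot (rsub xi l) x))%:E)).
    by rewrite integral_cube_ind integral_cos_cube PE add0r.
  by move=> x _; rewrite /ptdot /= add0r rdot_rsub mulrBr cosB; congr EFin; ring.
have -> : dot f (expo (l, true)) = sin th * P.
  rewrite /ip /Rintegral.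
  rewrite (eq_integral (fun x =>
      (\1_(cube a) x * cos (- (pi / 2) + 2 * pi * rdot (rsub xi l) x))%:E)).
    by rewrite integral_cube_ind integral_cos_cube PE (addrC (- (pi / 2))) cosBpihalf.
  move=> x _; rewrite /ptdot /= (addrC (- (pi / 2))) cosBpihalf rdot_rsub mulrBr sinB;
    congr EFin.
  by ring.
rewrite !exprMn -mulrDl cos2Dsin2 mul1r /P -prodrXl //.
Qed.

Let both (s : seq (Rd R d)) := [seq (l, false) | l <- s] ++ [seq (l, true) | l <- s].

Let uniq_both s : uniq s -> uniq (both s).
Proof.
move=> us; rewrite cat_uniq !map_inj_uniq ?us //=; try by move=> ? ? [].
by rewrite andbT; apply/hasPn => _ /mapP[l ls ->]; apply/negP => /mapP[].
Qed.

Let sum_both s : \sum_(i <- both s) (dot f (expo i)) ^+ 2 =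
  \sum_(l <- s) \prod_(i < d) sinc (rcoord xi i - rcoord l i) ^+ 2.
Proof.
rewrite /both big_cat /= !big_map -big_split /=; apply: eq_bigr => l _;
  exact: ip_expo_cube_expo.
Qed.

Let Pg i : bounded_pair (expo i). Proof. exact: bounded_expo. Qed.
Let Pf : bounded_pair f. Proof. exact: bounded_expo_cube. Qed.

Lemma expo_bessel s : uniq s -> (forall l, l \in s -> L l) ->
  \sum_(l <- s) \prod_(i < d) sinc (rcoord xi i - rcoord l i) ^+ 2 <= w.
Proof.
move=> us sL; rewrite -sum_both -[leRHS]mulr1 -ip_expo_cube.
apply: (bessel mD finD w0 Pg expo_orth expo_norm Pf (uniq_both us)) => i.
by rewrite mem_cat => /orP[] /mapP[l /sL Ll ->].
Qed.

Hypothesis complete : forall u v : Rd R d -> R, L2 D u v ->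
  (forall l, L l ->
    (\int[leb R d]_(x in D)
       (u x * cos (2 * pi * rdot l x) + v x * sin (2 * pi * rdot l x))%:E = 0)%E /\
    (\int[leb R d]_(x in D)
       (v x * cos (2 * pi * rdot l x) - u x * sin (2 * pi * rdot l x))%:E = 0)%E) ->
  {ae leb R d, forall x, D x -> u x = 0 /\ v x = 0}.

Lemma expo_parseval delta : 0 < delta -> exists s, [/\ uniq s, forall l, l \in s -> L l &
  w * (1 - delta) < \sum_(l <- s) \prod_(i < d) sinc (rcoord xi i - rcoord l i) ^+ 2].
Proof.
move=> delta0.
have compl (u v : Rd R d -> R) : measurable_fun setT u -> measurable_fun setT v ->
  (\int[leb R d]_(x in D) ((u x) ^+ 2 + (v x) ^+ 2)%:E < +oo)%E ->
  (forall i, LL i -> \int[leb R d]_(x in D) (u x * (expo i x).1 + v x * (expo i x).2)%:E =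
    0)%E ->
  (\int[leb R d]_(x in D) ((u x) ^+ 2 + (v x) ^+ 2)%:E = 0)%E.
  move=> mu_ mv fin uv0.
  have /complete ae0 : L2 D u v by split => //; exact: measurable_funTS.
  apply: (etrans _ (integral0 (leb R d) D)); apply: ae_eq_integral => //.
  - apply: measurable_funTS; apply/measurable_EFinP.
    by apply: measurable_funD; apply: measurable_funX.
  - have /ae0 : forall l, L l ->
      (\int[leb R d]_(x in D)
         (u x * cos (2 * pi * rdot l x) + v x * sin (2 * pi * rdot l x))%:E = 0)%E /\
      (\int[leb R d]_(x in D)
         (v x * cos (2 * pi * rdot l x) - u x * sin (2 * pi * rdot l x))%:E = 0)%E.
      move=> l Ll; split; first exact: (uv0 (l, false)).
      rewrite -(uv0 (l, true)) //; apply: eq_integral => x _; congr EFin => /=; ring.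
    by apply: filterS => x uv Dx; have [-> ->] := uv Dx; rewrite expr0n addr0.
have [s [us sL Es]] := complete_residual mD finD w0 Pg expo_orth expo_norm compl Pf delta0.
(* The family may contain only one of [e_l] and [i e_l]; adding the other can only increase the sum
   of squares. *)
exists (undup [seq i.1 | i <- s]); split; first exact: undup_uniq.
  by move=> l; rewrite mem_undup => /mapP[i /sL Li ->].
rewrite -sum_both.
apply: (@lt_le_trans _ _ (\sum_(i <- s) dot f (expo i) ^+ 2)).
  move: Es; rewrite (ip_residual (@bounded_pair_lin R _ _) (ipC (leb R d) D) (ip_lin mD
    finD) w0 Pg expo_orth expo_norm Pf us sL).
  rewrite ip_expo_cube ltrBlDr -ltrBlDl ltr_pdivlMr // mulrC.
  by [].
apply: ler_sum_sub => //; first exact/uniq_both/undup_uniq.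
  by move=> i; exact: sqr_ge0.
move=> [l b] ls; have l' : l \in undup [seq i.1 | i <- s].
  by rewrite mem_undup; apply/mapP; exists (l, b).
by case: b ls => ls; rewrite mem_cat; apply/orP; [right|left]; apply: map_f.
Qed.

End TestFunction.
End ExponentialSystem.

(** * Density of spectra *)

Section Counting.
Variable R : realType.

Definition in_cell d (k : nat -> int) (l : Rd R d) : bool :=
  [forall i : 'I_d, Num.floor (rcoord l i) == k i].

Lemma in_cellS d k (l : Rd R d.+1) :
  in_cell k l = (Num.floor (l.1 : R) == k 0%N) && in_cell (fun i => k i.+1) (l.2 : Rd R d).
Proof.
apply/forallP/andP => [H|[H0 /forallP H] i].
  by split; [exact: (H ord0)|apply/forallP => i; exact: (H (lift ord0 i))].
by case: (unliftP ord0 i) => [j ->|-> //]; exact: H.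
Qed.

(** Induction on [d], grouping points by the cell of the first coordinate: each group projects to a
    list with at most [m] entries per cell. Lists, not sets, since projection may create
    repetitions. *)
Lemma sum_prod_count d (V : R -> R) (s : int -> R) (S : R) m (F : seq (Rd R d)) :
  (forall t, 0 <= V t) -> (forall t, V t <= s (Num.floor t)) ->
  (forall K : seq int, uniq K -> \sum_(k <- K) s k <= S) ->
  (forall k : nat -> int, (count (in_cell k) F <= m)%N) ->
  \sum_(l <- F) \prod_(i < d) V (rcoord l i) <= m%:R * S ^+ d.
Proof.
move=> V0 Vs sS; elim: d F => [|d IH] F cF.
  under eq_bigr do rewrite big_ord0.
  rewrite big_const_seq iter_addr addr0 expr0 mulr1 ler_nat.
  (* In dimension 0 the only cell contains all of [F]. *)
  apply: leq_trans (cF (fun=> 0)); apply: sub_count => l _; apply/forallP; by case.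
have S0 : 0 <= S by have := sS [::] isT; rewrite big_nil.
pose K := undup [seq Num.floor (l.1 : R) | l <- F].
have s0 k : 0 <= s k by have := Vs k%:~R; rewrite intrKfloor; exact: le_trans.
have -> : \sum_(l <- F) \prod_(i < d.+1) V (rcoord l i) =
    \sum_(k <- K) \sum_(l <- F | Num.floor (l.1 : R) == k) \prod_(i < d.+1) V (rcoord l i).
  rewrite (exchange_big_dep xpredT) //= big_seq [RHS]big_seq; apply: eq_bigr => l lF.
  move: (\prod_(_ < _) _) => G;
    rewrite big_mkcond /= (bigD1_seq (Num.floor (l.1 : R))) ?undup_uniq //=; last first.
    by rewrite mem_undup; apply/mapP; exists l.
  by rewrite eqxx big1 ?addr0 // => k; rewrite eq_sym => /negPf ->.
apply: (@le_trans _ _ (\sum_(k <- K) s k * (m%:R * S ^+ d))); last first.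
  rewrite -mulr_suml exprS [leRHS]mulrCA; apply: ler_wpM2r; last by apply: sS;
    exact: undup_uniq.
  by rewrite mulr_ge0 // exprn_ge0.
apply: ler_sum => k _.
apply: (@le_trans _ _ (\sum_(l <- F | Num.floor (l.1 : R) == k)
    s k * \prod_(i < d) V (rcoord (l.2 : Rd R d) i))).
  apply: ler_sum => l /eqP lk; rewrite big_ord_recl /= -lk.
  apply: ler_wpM2r; [by apply: prodr_ge0|exact: Vs].
rewrite -mulr_sumr; apply: ler_wpM2l => //.
rewrite -big_filter -(big_map (fun l : Rd R d.+1 => l.2 : Rd R d) xpredT
  (fun l => \prod_(i < d) V (rcoord l i))).
apply: IH => k'; apply: leq_trans (cF (fun i => if i is i'.+1 then k' i' else k)).
rewrite count_map count_filter; apply: sub_count => l /=.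
by rewrite in_cellS /= andbC.
Qed.

(** Telescoping, from [1/(n-1)^2 <= 1/(n-2) - 1/(n-1)]; the factor 2 accounts for both signs of
    [k]. *)
Lemma tail_sum M (K : seq int) : (2 <= M)%N -> uniq K ->
  \sum_(k <- K) (if (`|k| <= M)%N then 0 else (`|k|.-1%:R : R) ^- 2) <= 2 / M.-1%:R.
Proof.
move=> M2 uK; pose h n : R := if (n <= M)%N then 0 else n.-1%:R ^- 2.
have h0 n : 0 <= h n by rewrite /h; case: ifP => // _; rewrite invr_ge0 sqr_ge0.
have hsum p : \sum_(n <- iota 0 (M.+1 + p)) h n <= M.-1%:R^-1 - (M.-1 + p)%:R^-1.
  elim: p => [|p IH].
    rewrite !addn0 subrr big_seq big1 // => n; rewrite mem_iota add0n ltnS => /andP[_ nM].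
    by rewrite /h nM.
  rewrite addnS -addn1 iotaD big_cat /= big_seq1 add0n.
  apply: le_trans (lerD IH (lexx _)) _.
  rewrite /h ifF; last by lia.
  have -> : (M.+1 + p).-1 = (M.-1 + p).+1 by lia.
  rewrite addnS; set a := (M.-1 + p)%N; have a0 : (0 < a)%N by lia.
  have : 0 < a%:R :> R by rewrite ltr0n.
  rewrite -natr1; move: (a%:R : R) => x x0.
  have -> : M.-1%:R^-1 - x^-1 + (x + 1) ^- 2 =
      M.-1%:R^-1 - (x + 1)^-1 - (x^-1 - (x + 1)^-1 - (x + 1) ^- 2) by ring.
  rewrite lerBlDr lerDl.
  have -> : x^-1 - (x + 1)^-1 - (x + 1) ^- 2 = (x * (x + 1) ^+ 2)^-1.
    by field; apply/andP; split; lra.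
  by rewrite invr_ge0 mulr_ge0 ?sqr_ge0 // ltW.
pose B := (M.+1 + \max_(k <- K) `|k|)%N.
have hB p : \sum_(n <- iota 0 (M.+1 + p)) h n <= M.-1%:R^-1.
  by apply: le_trans (hsum _) _; rewrite lerBlDr lerDl invr_ge0.
apply: (@le_trans _ _ (\sum_(k <- [seq Posz n | n <- iota 0 B] ++ [seq Negz n | n <- iota 0 B])
    h `|k|%N)).
  apply: ler_sum_sub => //.
    move: B => b; rewrite cat_uniq !map_inj_uniq ?iota_uniq; try by move=> ? ? [].
    by rewrite andbT; apply/hasPn => _ /mapP[n _ ->]; apply/negP => /mapP[].
    by move=> k; exact: (h0 `|k|%N).
  move=> k kK; have kB : (`|k| < B)%N.
    rewrite /B addSn ltnS; apply: leq_trans (leq_addl M _).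
    exact: (@leq_bigmax_seq _ _ _ (fun k : int => `|k|%N) _ kK isT).
  rewrite mem_cat; case: k kK kB => n kK kB; apply/orP; [left|right]; apply: map_f;
    rewrite mem_iota /= add0n; move: kB => /=; lia.
(* [Negz n] has absolute value [n + 1], so the negative half uses the range that is one longer. *)
have := hB (\max_(k <- K) `|k|%N).+1; have := hB (\max_(k <- K) `|k|%N); rewrite addnS -/B.
move: (B) => b h1 h2; rewrite big_cat !big_map mulr_natl mulr2n; apply: lerD => //.
apply: le_trans h2; rewrite /= big_cons -[1%N]addn0 iotaDl big_map.
by rewrite lerDr.
Qed.

End Counting.

(** * The function sinc and the sums of its squared translates *)

Section SincBounds.
Variable R : realType.
Implicit Types x t : R.

Lemma sincN x : sinc (- x) = sinc x.
Proof. by rewrite /sinc oppr_eq0 mulrN sinN invrN mulrNN. Qed.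

Lemma sinc_sq_le x : x != 0 -> sinc x ^+ 2 <= x ^- 2.
Proof.
move=> x0; rewrite /sinc (negPf x0) exprMn exprVn.
have p2 := pi_ge2 R; have x20 : 0 < x ^+ 2 by rewrite exprn_even_gt0.
have s1 : sin (pi * x) ^+ 2 <= 1 by rewrite sin2cos2 lerBlDr lerDl sqr_ge0.
apply: (@le_trans _ _ (((pi * x) ^+ 2)^-1)).
  by rewrite -[leRHS]mul1r; apply: ler_wpM2r => //; rewrite invr_ge0 sqr_ge0.
rewrite lef_pV2 ?posrE //; last by rewrite exprMn mulr_gt0 // exprn_gt0 // pi_gt0.
rewrite exprMn -[leLHS]mul1r; apply: ler_wpM2r; first exact: ltW.
by move: p2; move: (pi : R) => p; nra.
Qed.

Lemma sinc_int (m : int) : m != 0 -> sinc (m%:~R : R) = 0.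
Proof.
move=> m0; rewrite /sinc intr_eq0 (negPf m0).
have sn n : sin (pi * n%:R) = 0 :> R.
  rewrite mulr_natr -[pi *+ n]add0r; have /alternatingn-> := @sinDpi R.
  by rewrite sin0 mulr0.
by case: m {m0} => n; rewrite ?NegzE ?mulrNz ?mulrN ?sinN [sin _]sn ?oppr0 mul0r.
Qed.

Lemma sinc_neq0 x : `|x| < 1 -> sinc x != 0.
Proof.
move=> x1; rewrite /sinc; case: (eqVneq x 0) => [_|x0]; first exact: oner_neq0.
have p0 := pi_gt0 R; rewrite mulf_neq0 ?invr_eq0 ?mulf_neq0 ?(gt_eqF p0) //.
wlog xp : x x1 x0 / 0 < x.
  move=> H; have [xp|xn|e] := ltgtP x 0; last by rewrite e eqxx in x0.
    have := H (- x); rewrite normrN oppr_eq0 oppr_gt0 mulrN sinN oppr_eq0; exact.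
  exact: H.
rewrite gtr0_norm // in x1; rewrite gt_eqF // sin_gt0_pi // mulr_gt0 //=.
by rewrite -[ltRHS]mulr1 ltr_pM2l.
Qed.

Lemma integral_expo_cube d (l : Rd R d) a :
  (\int[leb R d]_(x in cube a) (cos (2 * pi * rdot l x))%:E =
   (cos (2 * pi * \sum_(i < d) rcoord l i * (a i + 2^-1)) *
     \prod_(i < d) sinc (rcoord l i))%:E)%E /\
  (\int[leb R d]_(x in cube a) (sin (2 * pi * rdot l x))%:E =
   (sin (2 * pi * \sum_(i < d) rcoord l i * (a i + 2^-1)) *
     \prod_(i < d) sinc (rcoord l i))%:E)%E.
Proof.
split.
  have := integral_cos_cube l 0 a; rewrite add0r => <-.
  by apply: eq_integral => x _; rewrite add0r.
have := integral_cos_cube l (- (pi / 2)) a; rewrite addrC cosBpihalf => <-.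
by apply: eq_integral => x _; rewrite addrC cosBpihalf.
Qed.

Definition sinc_sum N t : R := \sum_(j < N) sinc (j%:R - t) ^+ 2.

Lemma sinc_sum_ge0 N t : 0 <= sinc_sum N t.
Proof. by apply: sumr_ge0 => j _; exact: sqr_ge0. Qed.

(** Bessel's inequality on [[0,1)] for the orthonormal exponentials of integer frequency, tested on
    the exponential of frequency [t]. *)
Lemma sinc_sum_le1 N t : sinc_sum N t <= 1.
Proof.
pose p (n : nat) : Rd R 1 := @of_coord R 1 (fun=> n%:R).
have p0 n : rcoord (p n) 0 = n%:R by [].
pose z := (fun=> 0) : nat -> R.
have orth l m : range p l -> range p m -> l <> m ->
    (\int[leb R 1]_(x in cube z) (cos (2 * pi * rdot (rsub l m) x))%:E = 0)%E /\
    (\int[leb R 1]_(x in cube z) (sin (2 * pi * rdot (rsub l m) x))%:E = 0)%E.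
  move=> [j _ <-] [k _ <-] jk.
  have [-> ->] := integral_expo_cube (rsub (p j) (p k)) z.
  rewrite big_ord_recl rcoord_rsub !p0 (_ : j%:R - k%:R = (j%:Z - k%:Z)%:~R); last first.
    by rewrite intrB.
  rewrite sinc_int ?mul0r ?mulr0 //; rewrite subr_eq0; apply/eqP => -[e].
  by apply: jk; rewrite e.
have [mc lc] := @cube_measure R 1 z.
have := @expo_bessel R 1 (cube z) 1 (range p) mc lc ltr01 orth (@of_coord R 1 (fun=> t)) z
  (@subset_refl _ _) [seq p n | n <- index_iota 0 N].
rewrite big_map big_mkord.
under eq_bigr => n _.
  rewrite big_ord_recl big_ord0 mulr1 p0 /= -sincN opprB; over.
apply.
  by rewrite map_inj_uniq ?iota_uniq // => m n [] /eqP; rewrite eqr_nat => /eqP.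
by move=> l /mapP[n _ ->]; exists n.
Qed.

(* [tail M (k - j)] bounds [sinc (j - t) ^ 2] for [t] in [[k, k + 1)] away from [j]. *)
Definition tail M (k : int) : R := if (`|k| <= M)%N then 0 else `|k|.-1%:R ^- 2.
Definition window (M N : nat) (k : int) : bool := (- M%:Z <= k) && (k < N%:Z + M%:Z).
Definition cell_bound M N (k : int) : R := (window M N k)%:R + \sum_(j < N) tail M (k - j%:Z).

Lemma tail_ge0 M k : 0 <= tail M k.
Proof. by rewrite /tail; case: ifP => // _; rewrite invr_ge0 sqr_ge0. Qed.

(** In the window the bound 1 is enough. Outside, [t] is within 1 of its floor [k], so
    [|j - t| >= |k - j| - 1], whence the predecessor in [tail]. *)
Lemma sinc_sum_cell M N t : (0 < M)%N -> sinc_sum N t <= cell_bound M N (Num.floor t).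
Proof.
move=> M0; rewrite /cell_bound; case: (boolP (window M N _)) => [_|out].
  by rewrite -[leLHS]addr0; apply: lerD; [exact: sinc_sum_le1|apply: sumr_ge0 => j _;
    exact: tail_ge0].
rewrite add0r; apply: ler_sum => j _; have := floor_itv t; move: (Num.floor t) out => k out.
have jN := ltn_ord j.
have kM : (M < `|k - j%:Z|)%N by move: out; rewrite /window; lia.
rewrite /tail ifF; last by apply/negbTE; rewrite -ltnNge.
have far : (`|k - j%:Z|.-1%:R : R) <= `|k%:~R - j%:R| - 1.
  have -> : (k%:~R - j%:R : R) = (k - j%:Z)%:~R by rewrite intrB.
  have -> : `|(k - j%:Z)%:~R : R| = `|k - j%:Z|%N%:R by rewrite -intr_norm -abszE.
  by rewrite -[X in _ <= X%:R - _]prednK ?(leq_ltn_trans _ kM) // -natr1 addrK.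
move=> /andP[kt tk]; rewrite intrD in tk.
have e0 : 0 < (`|k - j%:Z|.-1%:R : R) by rewrite ltr0n; lia.
have le : (`|k - j%:Z|.-1%:R : R) <= `|j%:R - t|.
  apply: le_trans far _; rewrite distrC lerBlDr.
  have -> : j%:R - k%:~R = (j%:R - t) + (t - k%:~R) by ring.
  apply: le_trans (ler_normD _ _) _; rewrite lerD2l ger0_norm; lra.
have ne : j%:R - t != 0 by rewrite -normr_gt0; exact: lt_le_trans le.
apply: le_trans (sinc_sq_le ne) _.
have p1 : 0 < (j%:R - t) ^+ 2 by rewrite exprn_even_gt0.
rewrite lef_pV2 ?posrE //; last exact: exprn_gt0.
by rewrite -[leRHS]ger0_norm ?sqr_ge0 // normrX ler_pXn2r ?nnegrE // ltW.
Qed.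

Lemma cell_bound_sum M N (K : seq int) : (2 <= M)%N -> uniq K ->
  \sum_(k <- K) cell_bound M N k <= (N + M.*2)%:R + N%:R * (2 / M.-1%:R).
Proof.
move=> M2 uK; rewrite big_split; apply: lerD.
  rewrite -natr_sum ler_nat -big_mkcond sum1_count -size_filter.
  have -> : (N + M.*2)%N = size [seq (n%:Z - M%:Z) | n <- iota 0 (N + M.*2)].
    by rewrite size_map size_iota.
  apply: uniq_leq_size; first exact: filter_uniq.
  move=> k; rewrite mem_filter => /andP[/andP[k1 k2] _].
  apply/mapP; exists `|(k + M%:Z)%R|%N; last by lia.
  by rewrite mem_iota; lia.
rewrite exchange_big /=; apply: (@le_trans _ _ (\sum_(j < N) 2 / M.-1%:R)); last first.
  by rewrite sumr_const card_ord [leRHS]mulr_natl.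
apply: ler_sum => j _; rewrite -(big_map (fun k : int => k - j%:Z) xpredT (tail M)).
apply: tail_sum => //; rewrite map_inj_uniq // => k k' /eqP.
by rewrite (can_eq (subrK _)) => /eqP.
Qed.

End SincBounds.

(** * Fourier transform of a union of unit cubes *)

Section CubeUnion.
Variables (R : realType) (d : nat) (A : {fset 'rV[int]_d}).
Implicit Types l m : Rd R d.

Local Notation Om := (@cube_union R d A).
Local Notation cube_at a := (cube (rcoord (@of_int R d a))).

Lemma cube_atE a (x : Rd R d) : cube_at a x <-> floorv x = a.
Proof.
split=> [xa|<- i id].
  apply/rowP => i; rewrite !mxE; apply/eqP; rewrite floor_eq intrD.
  by rewrite -rcoord_of_int; exact: xa.
have := rcoord_of_int R (floorv x) (Ordinal id); rewrite /= => ->.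
by rewrite !mxE -[1]/(1%:~R) -intrD; exact: floor_itv.
Qed.

Lemma cube_union_bigU : Om = \big[setU/set0]_(a <- A) cube_at a.
Proof.
apply/seteqP; split => x.
  move=> /cube_unionE xA; rewrite -bigcup_seq; exists (floorv x) => //.
  exact/cube_atE.
by rewrite -bigcup_seq => -[a aA /cube_atE xa]; apply/cube_unionE; rewrite xa.
Qed.

Lemma measurable_cube_union : measurable Om.
Proof.
rewrite cube_union_bigU; apply: bigsetU_measurable => a _; exact: (cube_measure _ _).1.
Qed.

Lemma integral_cube_union (f : Rd R d -> R) : measurable_fun setT f ->
  (\int[leb R d]_(x in Om) (f x)%:E =
   \sum_(a <- A) \int[leb R d]_(x in cube_at a) (f x)%:E)%E.
Proof.
move=> mf; rewrite cube_union_bigU integral_bigsetU_EFin //.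
- by move=> a; exact: (cube_measure _ _).1.
- by move=> a b _ _ [x [/cube_atE <- /cube_atE <-]].
- by apply: measurable_funTS; exact/measurable_EFinP.
Qed.

Lemma leb_cube_union : leb R d Om = (#|` A|%:R)%:E.
Proof.
have := @integral_cube_union (fun=> 1) (measurable_cst _).
rewrite integral_cst ?mul1e; last exact: measurable_cube_union.
move=> /= e; apply: etrans e _.
rewrite (eq_bigr (fun=> 1%:E)) => [|a _].
  by rewrite sumEFin big_const_seq count_predT iter_addr addr0.
rewrite integral_cst ?mul1e; last exact: (cube_measure _ _).1.
exact: (cube_measure _ _).2.
Qed.

Lemma integral_expo_union_eq0 (l : Rd R d) :
  (forall i, (i < d)%N -> `|rcoord l i| < 1) ->
  (\int[leb R d]_(x in Om) (cos (2 * pi * rdot l x))%:E = 0)%E ->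
  (\int[leb R d]_(x in Om) (sin (2 * pi * rdot l x))%:E = 0)%E ->
  \sum_(a <- A) expi2pi (rdot l (of_int R a)) = 0.
Proof.
move=> l1; rewrite !integral_cube_union; last 2 first.
- exact: (bounded_sin l).1.
- exact: (bounded_cos l).1.
pose P := \prod_(i < d) sinc (rcoord l i).
have P0 : P != 0 by apply/prodf_neq0 => i _; apply: sinc_neq0; exact: l1.
(* The phase due to cube centres, offset by 1/2 from the corners; it is common to all cubes and
   factors out as [expi2pi k]. *)
pose k := \sum_(i < d) rcoord l i * 2^-1.
have thE a : \sum_(i < d) rcoord l i * (rcoord (of_int R a) i + 2^-1) = rdot l (of_int R a)
  + k.
  by rewrite -big_split; apply: eq_bigr => i _; rewrite mulrDr.
under eq_bigr do rewrite (integral_expo_cube _ _).1 thE.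
rewrite sumEFin -mulr_suml => -[/eqP]; rewrite mulf_eq0 (negPf P0) orbF => /eqP c0.
under eq_bigr do rewrite (integral_expo_cube _ _).2 thE.
rewrite sumEFin -mulr_suml => -[/eqP]; rewrite mulf_eq0 (negPf P0) orbF => /eqP s0.
apply: (mulfI (expi2pi_neq0 k)); rewrite mulr0 mulr_sumr.
under eq_bigr do rewrite -expi2piD addrC.
have sumC (s : seq 'rV[int]_d) (u v : 'rV[int]_d -> R) :
    \sum_(a <- s) Complex (u a) (v a) = Complex (\sum_(a <- s) u a) (\sum_(a <- s) v a).
  elim: s => [|a s IH]; first by rewrite !big_nil.
  by rewrite !big_cons IH.
by rewrite sumC c0 s0.
Qed.

End CubeUnion.

Lemma bernoulli_ge (R : realFieldType) (e : R) d : 0 <= e <= 1 ->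
  1 - d%:R * e <= (1 - e) ^+ d.
Proof.
move=> /andP[e0 e1]; elim: d => [|d IH]; first by rewrite mul0r subr0.
rewrite exprS -natr1; apply: le_trans (ler_wpM2l _ IH); last by rewrite subr_ge0.
have : 0 <= d%:R * e ^+ 2 by rewrite mulr_ge0 // sqr_ge0.
by move: (d%:R) => x; nra.
Qed.

Section Density.
Variables (R : realType) (d : nat) (A : {fset 'rV[int]_d}) (L : set (Rd R d)).
Local Notation Om := (@cube_union R d A).
Hypothesis A0 : A != fset0.
Hypothesis orth : forall l m, L l -> L m -> l <> m ->
  (\int[leb R d]_(x in Om) (cos (2 * pi * rdot (rsub l m) x))%:E = 0)%E /\
  (\int[leb R d]_(x in Om) (sin (2 * pi * rdot (rsub l m) x))%:E = 0)%E.
Hypothesis complete : forall u v : Rd R d -> R, L2 Om u v ->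
  (forall l, L l ->
    (\int[leb R d]_(x in Om)
       (u x * cos (2 * pi * rdot l x) + v x * sin (2 * pi * rdot l x))%:E = 0)%E /\
    (\int[leb R d]_(x in Om)
       (v x * cos (2 * pi * rdot l x) - u x * sin (2 * pi * rdot l x))%:E = 0)%E) ->
  {ae leb R d, forall x, Om x -> u x = 0 /\ v x = 0}.

Let n := #|` A|.

(** Approximate Parseval at each of the [N ^ d] integer frequencies of a box. Merging the finite
    families adds only nonnegative terms, and distributivity turns the sum over frequencies into a
    product. *)
Lemma spectrum_box_sum delta N : 0 < delta -> exists F : seq (Rd R d),
  [/\ uniq F, forall l, l \in F -> L l &
   (n%:R * (1 - delta)) * N%:R ^+ d <= \sum_(l <- F) \prod_(i < d) sinc_sum N (rcoord l i)].
Proof.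
move=> delta0.
have [a0 a0A] : exists a, a \in A by apply/fset0Pn.
have n0 : 0 < n%:R :> R by rewrite ltr0n cardfs_gt0.
have sub : cube (rcoord (of_int R a0)) `<=` Om.
  by move=> x /cube_atE xa; apply/cube_unionE; rewrite xa.
pose pt (xi : {ffun 'I_d -> 'I_N}) : Rd R d :=
  @of_coord R d (fun i => (if insub i is Some j then xi j : nat else 0%N)%:R).
have ptE xi (i : 'I_d) : rcoord (pt xi) i = (xi i)%:R by rewrite rcoord_of_coord // valK.
have /choice[s sP] xi := expo_parseval (measurable_cube_union R A) (leb_cube_union R A) n0 orth
  (pt xi) sub complete delta0.
pose F := undup (flatten [seq s xi | xi <- enum {: {ffun 'I_d -> 'I_N}}]).
have sF xi l : l \in s xi -> l \in F.
  by move=> ls; rewrite mem_undup; apply/flatten_mapP; exists xi; rewrite ?mem_enum.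
exists F; split; first exact: undup_uniq.
  by move=> l; rewrite mem_undup => /flatten_mapP[xi _ lx]; case: (sP xi) => _ + _; apply.
have -> : n%:R * (1 - delta) * N%:R ^+ d = \sum_(xi :
  {ffun 'I_d -> 'I_N}) n%:R * (1 - delta) :> R.
  by rewrite sumr_const card_ffun !card_ord -natrX mulr_natr.
apply: (@le_trans _ _ (\sum_(xi : {ffun 'I_d -> 'I_N})
    \sum_(l <- F) \prod_(i < d) sinc ((xi i)%:R - rcoord l i) ^+ 2)).
  apply: ler_sum => xi _; have [us sL lt] := sP xi; apply: le_trans (ltW lt) _.
  apply: le_trans (ler_sum_sub us (undup_uniq _) _ (sF xi)) _.
    by move=> l; apply: prodr_ge0 => i _; exact: sqr_ge0.
  by apply: ler_sum => l _; rewrite le_eqVlt; apply/orP; left; apply/eqP;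
     apply: eq_bigr => i _; rewrite ptE.
rewrite exchange_big; apply: ler_sum => l _.
by rewrite /sinc_sum bigA_distr_bigA.
Qed.

(* Otherwise the sum of [spectrum_box_sum], at least about [n * N ^ d], would be at
   most about [(n - 1) * N ^ d]. *)
Lemma spectrum_dense_cell : exists (s : seq (Rd R d)) (k : nat -> int),
  [/\ uniq s, size s = n, forall l, l \in s -> L l & forall l, l \in s -> in_cell k l].
Proof.
have n0 : (0 < n)%N by rewrite cardfs_gt0.
have [//|no] := pselect (exists (s : seq (Rd R d)) (k : nat -> int),
  [/\ uniq s, size s = n, forall l, l \in s -> L l & forall l, l \in s -> in_cell k l]).
have few F k : uniq F -> (forall l, l \in F -> L l) -> (count (in_cell k) F <= n.-1)%N.
  move=> uF FL; rewrite leqNgt; apply/negP => big; apply: no.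
  exists (take n [seq l <- F | in_cell k l]), k; split.
  - by rewrite take_uniq // filter_uniq.
  - by rewrite size_takel // size_filter; move: big; rewrite prednK.
  - by move=> l /mem_take; rewrite mem_filter => /andP[_ /FL].
  - by move=> l /mem_take; rewrite mem_filter => /andP[].
exfalso.
(* Chosen so that [n e (d + 1) = 1/2], which makes [n (1 - e) <= (n - 1) (1 + e)^d] impossible. *)
pose e : R := (2 * n%:R * d.+1%:R)^-1.
have nR : 1 <= n%:R :> R by rewrite ler1n.
have dR : 1 <= d.+1%:R :> R by rewrite ler1n.
have q1 : 1 <= n%:R * d.+1%:R :> R by exact: mulr_ege1.
have q0 : 0 < 2 * n%:R * d.+1%:R :> R by rewrite -mulrA; lra.
have e0 : 0 < e by rewrite invr_gt0.
have ee : e * (2 * n%:R * d.+1%:R) = 1 by rewrite mulVf // gt_eqF.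
have e1 : e <= 1 by rewrite invf_le1 // -mulrA; lra.
(* [M] keeps the tail share [2/(M-1)] below [e/2], and [N] keeps the window excess [2M] below
   [N e/2]; so [S <= N (1 + e)]. *)
have [M0 M0P] : exists M0 : nat, 4 / e <= M0%:R.
  by exists (Num.truncn (4 / e)).+1; apply: ltW; exact: truncnS_gt.
pose M := M0.+2.
have [N0 N0P] : exists N0 : nat, 4 * M%:R / e <= N0%:R.
  by exists (Num.truncn (4 * M%:R / e)).+1; apply: ltW; exact: truncnS_gt.
pose N := N0.+1.
have N0' : 0 < N%:R :> R by rewrite ltr0n.
pose S := (N + M.*2)%:R + N%:R * (2 / M.-1%:R) : R.
have SN : S <= N%:R * (1 + e).
  have -> : S = N%:R + M%:R * 2 + N%:R * (2 / M.-1%:R) by rewrite /S natrD -muln2 natrM.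
  have M1 : 2 / M.-1%:R <= e / 2.
    rewrite ler_pdivrMr ?ltr0n //; move: M0P; rewrite ler_pdivrMr // => M0P.
    have -> : M.-1%:R = M0%:R + 1 :> R by rewrite natr1.
    by move: M0P e0; move: (M0%:R) => x; lra.
  have M2 : M%:R * 2 <= N%:R * (e / 2).
    move: N0P; rewrite ler_pdivrMr // => N0P.
    have -> : N%:R = N0%:R + 1 :> R by rewrite natr1.
    by move: N0P e0; move: (N0%:R) (M%:R) => x y; lra.
  have := ler_wpM2l (ltW N0') M1; lra.
have [F [uF FL low]] := @spectrum_box_sum e N e0.
have M2 : (2 <= M)%N by [].
have up := sum_prod_count (sinc_sum_ge0 N) (fun t => sinc_sum_cell N t (isT : (0 < M)%N))
  (fun K uK => cell_bound_sum R N M2 uK) (fun k => few F k uF FL).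
have {low up} : n%:R * (1 - e) * N%:R ^+ d <= n.-1%:R * S ^+ d := le_trans low up.
have S0 : 0 <= S by rewrite addr_ge0 // mulr_ge0 // divr_ge0.
have : S ^+ d <= (N%:R * (1 + e)) ^+ d by rewrite lerXn2r ?nnegrE //; nra.
rewrite exprMn => Sd low.
have Nd : 0 < N%:R ^+ d :> R by exact: exprn_gt0.
have {low Sd S0} : n%:R * (1 - e) <= n.-1%:R * (1 + e) ^+ d.
  rewrite -(ler_pM2r Nd); apply: le_trans low _; rewrite -mulrA; apply: ler_wpM2l => //.
  by rewrite mulrC.
(* After multiplication by [1 - d e], Bernoulli and [(1 - e^2)^d <= 1] bound the right side by
   [n - 1], while the left side is at least [n - 1/2]. *)
have bern := @bernoulli_ge R e d; rewrite (ltW e0) e1 in bern; have {}bern := bern isT.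
have le1 : (1 + e) ^+ d * (1 - e) ^+ d <= 1.
  by rewrite -exprMn exprn_ile1 //; nra.
have pe : 0 < (1 + e) ^+ d by apply: exprn_gt0; lra.
have : (1 + e) ^+ d * (1 - d%:R * e) <= 1 by apply: le_trans le1; rewrite ler_pM2l.
have -> : n.-1%:R = n%:R - 1 :> R by rewrite -[in RHS](prednK n0) -natr1 addrK.
have D0 : 0 <= d%:R :> R by [].
rewrite -(natr1 d) in ee; move: ee pe nR D0 e0; clear.
move: ((1 + e) ^+ d) (d%:R : R) (n%:R : R) => p D m ee p0 m1 D0 e0 pD low.
have me : m * e * (D + 1) = 2^-1 by apply: (@mulfI _ 2) => //; rewrite divff // -[RHS]ee; ring.
have De : D * e <= 2^-1.
  by rewrite -me -mulrA -[leLHS]mul1r [e * _]mulrC; apply: ler_pM => //; nra.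
have h1 : m * (1 - e) * (1 - D * e) <= (m - 1) * p * (1 - D * e).
  by apply: ler_wpM2r => //; lra.
have h2 : (m - 1) * (p * (1 - D * e)) <= (m - 1) * 1 by apply: ler_wpM2l => //; lra.
have h3 : 0 <= m * e * (D * e) by rewrite !mulr_ge0 //; lra.
have : m * (1 - e) * (1 - D * e) = m - m * e * (D + 1) + m * e * (D * e) by ring.
by rewrite me; lra.
Qed.

End Density.

Theorem theorem2p4 (R : realType) (d : nat) (A : {fset 'rV[int]_d}) :
  A != fset0 -> (#|` A| <= 5)%N ->
  spectral (@cube_union R d A) -> tiles (@cube_union R d A).
Proof.
move=> A0 A5 [L [orth complete]].
have [s [k [us sn sL sk]]] := spectrum_dense_cell A0 orth complete.
have n0 : (0 < #|` A|)%N by rewrite cardfs_gt0.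
case An: #|` A| n0 A5 sn => [|n] // _ n5 sn.
pose a (i : 'I_n.+1) : 'rV[int]_d := nth 0 A i.
pose l (i : 'I_n.+1) : Rd R d := nth (of_int R 0) s i.
have li i : l i \in s by apply: mem_nth; rewrite sn.
pose phi i (z : 'rV[int]_d) := rdot (l i) (of_int R z).
have [|i j ij|c ac] := @spectral_tile_code R _ n a phi n5.
- move=> i x y; rewrite /phi /rdot -sumrB; apply: eq_bigr => j _.
  by rewrite !rcoord_of_int !mxE intrB mulrBr.
- have lij : l i <> l j.
    by move=> /eqP; rewrite nth_uniq ?sn // => /eqP/val_inj/eqP; rewrite (negPf ij).
  have [c0 s0] := orth _ _ (sL _ (li i)) (sL _ (li j)) lij.
  rewrite -[RHS](integral_expo_union_eq0 _ c0 s0).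
    have sA : size (enum_fset A) = n.+1 by exact: An.
    rewrite [RHS](big_nth 0) sA big_mkord; apply: eq_bigr => k' _.
    by rewrite rdot_rsub.
  move=> q qd; rewrite rcoord_rsub.
  have /forallP/(_ (Ordinal qd))/eqP /= fi := sk _ (li i).
  have /forallP/(_ (Ordinal qd))/eqP /= fj := sk _ (li j).
  have := floor_itv (rcoord (l i) q); have := floor_itv (rcoord (l j) q).
  rewrite fi fj intrD => /andP[? ?] /andP[? ?]; rewrite ltr_norml; apply/andP; split; lra.
apply: (@tile_code_tiles R d A n.+1 a c _ ac).
move=> x; split => [xA|[i ->]].
  have ix : (index x A < n.+1)%N by rewrite -An index_mem.
  by exists (Ordinal ix); rewrite /a /= nth_index.
by apply: mem_nth; rewrite An.
Qed.
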